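(* Let $\Omega\subset\mathbb{R}^n$ be a bounded domain and $1<p<\infty$. Let $v$ be a weight on $\Omega$ with $v\in L^1(\Omega)$, let $Q$ be a measurable, symmetric, nonnegative definite $n\times n$ matrix function on $\Omega$ with $|Q(x)|_{\mathrm{op}}^{p/2}\le k\,v(x)$ for a.e. $x\in\Omega$ (some constant $k$), and let $\mathbf t\cdot\nabla$ be a degenerate subunit vector field on $\Omega$. Suppose that for some $\sigma>1$ the Sobolev inequality $$\|\varphi\|_{L^N(v,\Omega)}\le S_N\|\nabla\varphi\|_{QL^p(\Omega)}\qquad\text{for all }\varphi\in \mathrm{Lip}_0(\Omega)$$ holds with $N(t)=t^{\sigma p}$. Let $f\in L^A(v,\Omega)$ and $g\in L^B(v,\Omega)$, where, with $\sigma'=\sigma/(\sigma-1)$, $$A(t)=t^{\sigma'(p-1)}\log(e+t)^{\sigma'(p-1)},\qquad B(t)=t^{p\sigma'}\log(e+t)^{p\sigma'}.$$ Let $r>0$ and $H(t)=t^r\exp(t)$. Then there is a constant $C$, depending only on $A,B,H,\mathbf t,p,S_N,\Omega,v$, such that every degenerate weak subsolution $u\in QH^{1,p}_0(v,\Omega)$ of the Dirichlet problem (D) (see context) satisfies $$\|u^+\|_{L^H(v,\Omega)}\le C\big(\|f\|_{L^A(v,\Omega)}+\|g\|_{L^B(v,\Omega)}\big),$$ and every degenerate weak supersolution $u\in QH^{1,p}_0(v,\Omega)$ of (D) satisfies the same bound with $u^-$ in place of $u^+$. In particular, if $u$ is a degenerate weak solution of (D), then $u\in L^H(v,\Omega)$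 with this bound (with a constant having the same dependence).
   Context: A weight $v$ is a nonnegative measurable function; $v(E)=\int_E v\,dx$. $L^p(v,\Omega)$ is the Lebesgue space with respect to the measure $v\,dx$. For an increasing function $\Phi:[0,\infty)\to[0,\infty)$ with $\Phi(0)=0$, $\|h\|_{L^\Phi(v,\Omega)}=\inf\{\lambda>0:\int_\Omega \Phi(|h|/\lambda)\,v\,dx\le 1\}$, and $L^\Phi(v,\Omega)$ is the set of measurable $h:\Omega\to\mathbb{R}$ for which this is finite. $\mathrm{Lip}_0(\Omega)$ is the set of locally Lipschitz functions with compact support in $\Omega$. $QL^p(\Omega)$ is the space of measurable $\mathbf g:\Omega\to\mathbb{R}^n$ with $\|\mathbf g\|_{QL^p(\Omega)}=(\int_\Omega|\sqrt{Q}\,\mathbf g|^p\,dx)^{1/p}<\infty$, with functions identified when their difference has norm $0$. $QH^{1,p}_0(v,\Omega)$ is the completion of $\mathrm{Lip}_0(\Omega)$ in the norm $\|\psi\|_{L^p(v,\Omega)}+\|\nabla\psi\|_{QL^p(\Omega)}$; its elements are identified with pairs $(u,\nabla u)\in L^p(v,\Omega)\times QL^p(\Omega)$ that are limits in $L^p(v,\Omega)\times QL^p(\Omega)$ of sequences $(\psi_j,\nabla\psi_j)$ with $\psi_j\in\mathrm{Lip}_0(\Omega)$. Here ''$\nabla u$'' is notation for the second component (it need not be a classical weak gradient), and one writes $u\in QH^{1,p}_0(v,\Omega)$ for the pair. For measurable $\mathbf t:\Omega\to\mathbb{R}^n$, $\mathbf t\cdot\nabla$ is a degenerate subunit vector field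 if there is a constant $C(\mathbf t)>0$ with $\|\mathbf t\cdot\nabla\varphi\|_{L^p(v,\Omega)}\le C(\mathbf t)\|\nabla\varphi\|_{QL^p(\Omega)}$ for every $\varphi\in\mathrm{Lip}_0(\Omega)$. Dependence of a constant on $\mathbf t$ includes dependence on $C(\mathbf t)$. The Dirichlet problem (D) is, formally, $$-v^{-1}\mathrm{div}(|\sqrt Q\nabla u|^{p-2}Q\nabla u)=f|f|^{p-2}-v^{-1}\mathrm{div}(v|g|^{p-2}g\,\mathbf t)\ \text{in }\Omega,\qquad u=0\text{ on }\partial\Omega,$$ with $f,g$ real-valued measurable functions. A pair $(u,\nabla u)\in QH^{1,p}_0(v,\Omega)$ is a degenerate weak solution of (D) if $$\int_\Omega|\sqrt Q\nabla u|^{p-2}\,\nabla\varphi\cdot Q\nabla u\,dx=\int_\Omega\big(f|f|^{p-2}\varphi+|g|^{p-2}g\,\mathbf t\cdot\nabla\varphi\big)\,v\,dx$$ for every $\varphi\in\mathrm{Lip}_0(\Omega)$. It is a degenerate weak subsolution (supersolution) if this holds with ''$=$'' replaced by ''$\le$'' (''$\ge$'') for every nonnegative $\varphi\in\mathrm{Lip}_0(\Omega)$. Expressions $|w|^{p-2}w$ are $0$ where $w=0$. Finally $u^+=\max(u,0)$, $u^-=\max(-u,0)$. *)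

(* Defs.v *)
From HB Require Import structures.
From mathcomp Require Import all_boot all_order all_algebra.
From mathcomp Require Import all_classical all_reals all_analysis.

Set Implicit Arguments.
Unset Strict Implicit.
Unset Printing Implicit Defensive.

Import Order.TTheory GRing.Theory Num.Theory.
Import numFieldNormedType.Exports.

Local Open Scope classical_set_scope.
Local Open Scope ring_scope.

(* Lebesgue measure on R^n.  The dimension is written n.+1, so that the empty
   set is a box (of volume 0). *)
Section lebesgue_outer_measure.
Context {R : realType} {n : nat}.
Implicit Types (a b : 'rV[R]_n.+1) (X : set 'rV[R]_n.+1).
Local Open Scope ereal_scope.

Definition box a b : set 'rV[R]_n.+1 :=
  [set x | forall i, (a ord0 i < x ord0 i <= b ord0 i)%R].

Definition box_volume a b : R := (\prod_i Num.max 0 (b ord0 i - a ord0 i))%R.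

Definition box_cover X : set (nat -> 'rV[R]_n.+1 * 'rV[R]_n.+1) :=
  [set F | X `<=` \bigcup_k box (F k).1 (F k).2].

Definition lebesgue_outer X : \bar R :=
  ereal_inf [set \sum_(k <oo) (box_volume (F k).1 (F k).2)%:E |
             F in box_cover X].

Let vol (ab : 'rV[R]_n.+1 * 'rV[R]_n.+1) : \bar R :=
  (box_volume ab.1 ab.2)%:E.

Lemma box_volume_ge0 a b : (0 <= box_volume a b)%R.
Proof. by apply: prodr_ge0 => i _; rewrite le_max lexx orTb. Qed.

Let vol_ge0 ab : 0 <= vol ab.
Proof. by rewrite lee_fin box_volume_ge0. Qed.

Lemma lebesgue_outer_ge0 X : 0 <= lebesgue_outer X.
Proof.
apply: le_ereal_inf_tmp => _ [F _ <-]; apply: nneseries_ge0 => k _ _.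
exact: vol_ge0.
Qed.

Lemma le_lebesgue_outer : {homo lebesgue_outer : A B / A `<=` B >-> A <= B}.
Proof.
move=> A B AB; apply: ereal_inf_le_tmp => _ [F BF <-].
by exists F => //; apply: subset_trans AB BF.
Qed.

Lemma lebesgue_outer0 : lebesgue_outer set0 = 0.
Proof.
apply/eqP; rewrite eq_le lebesgue_outer_ge0 andbT.
apply: ereal_inf_lbound; exists (fun=> (0, 0)%R); first exact: sub0set.
apply: eseries0 => k _ _ /=.
by rewrite /box_volume big_ord_recl subrr maxxx mul0r.
Qed.

Lemma lebesgue_outer_sigma_subadditive : sigma_subadditive lebesgue_outer.
Proof.
move=> A; have [[i ioo]|] := pselect (exists i, lebesgue_outer (A i) = +oo).
  rewrite (eseries_pinfty _ _ ioo) ?leey// => k _.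
  by rewrite -ltNye (lt_le_trans _ (lebesgue_outer_ge0 _)).
rewrite -forallNE => Aoo.
suff add2e (e : {posnum R}) : lebesgue_outer (\bigcup_k A k) <=
    \sum_(i <oo) lebesgue_outer (A i) + e%:num%:E.
  by apply/lee_addgt0Pr => _/posnumP[].
rewrite (le_trans _ (epsilon_trick _ _ _))//; last first.
  by move=> k; exact: lebesgue_outer_ge0.
pose P m (B : nat -> 'rV[R]_n.+1 * 'rV[R]_n.+1) := box_cover (A m) B /\
  \sum_(k <oo) vol (B k) <=
  lebesgue_outer (A m) + (e%:num / (2 ^ m.+1)%:R)%:E.
have [G PG] : {G : nat -> nat -> 'rV[R]_n.+1 * 'rV[R]_n.+1 &
    forall m, P m (G m)}.
  apply: (@choice _ _ P) => m; rewrite /P /lebesgue_outer.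
  set S := (X in ereal_inf X); move infS : (ereal_inf S) => iS.
  case: iS infS => [r Sr|Soo|Soo].
  - have em1 : (0 < e%:num / (2 ^ m.+1)%:R)%R by [].
    have /(lb_ereal_inf_adherent em1) : ereal_inf S \is a fin_num by rewrite Sr.
    move=> [x [B AmB muBx] xS].
    by exists B; split => //; rewrite muBx -Sr; exact/ltW.
  - by have := Aoo m; rewrite /lebesgue_outer Soo.
  - suff : lbound S 0 by move/le_ereal_inf_tmp; rewrite Soo.
    by move=> /= _ [B AmB <-]; by apply: nneseries_ge0 => k _ _; exact: vol_ge0.
have volG_ge0 x : 0 <= (vol \o uncurry G) x by exact: vol_ge0.
apply: (@le_trans _ _ (\esum_(i in setT) (vol \o uncurry G) i)).
  rewrite /lebesgue_outer; apply: ereal_inf_lbound => /=.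
  have /card_esym/ppcard_eqP[f] := card_nat2.
  exists (uncurry G \o f).
    move=> t [i _ Ait]; have [j _ Bijt] := (PG i).1 _ Ait.
    by exists (f^-1%FUN (i, j)) => //=; rewrite invK ?inE.
  rewrite -(esum_pred_image (vol \o uncurry G) _ xpredT) ?[fun=> _]set_true//.
  by rewrite image_eq.
rewrite (_ : esum _ _ = \sum_(i <oo) \sum_(j <oo) vol (G i j)); last first.
  pose J : nat -> set (nat * nat) := fun i => [set (i, j) | j in setT].
  rewrite (_ : setT = \bigcup_k J k); last first.
    by rewrite predeqE => -[a b]; split => // _; exists a => //; exists b.
  rewrite esum_bigcupT /=; last 2 first.
    - apply/trivIsetP => i j _ _ ij.
      rewrite predeqE => -[k m] /=; split => //= -[] [_] _ [<-{k} _].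
      by move=> [m' _] [] /esym/eqP; rewrite (negbTE ij).
    - by move=> [k m]; exact: vol_ge0.
  rewrite -(image_id [set: nat]) -fun_true esum_pred_image//; last first.
    by move=> k _; exact: esum_ge0.
  apply: eq_eseriesr => /= j _.
  rewrite -(esum_pred_image (vol \o uncurry G) (pair j) predT)//=; last first.
    by move=> ? ? _ _; exact: (@can_inj _ _ _ snd).
  by congr esum; rewrite predeqE => -[a b]; split; move=> [i _ <-]; exists i.
apply: lee_lim.
- apply: is_cvg_nneseries => k *.
  by apply: nneseries_ge0 => m *; exact: vol_ge0.
- apply: is_cvg_nneseries => k *.
  by apply: adde_ge0 => //; exact: lebesgue_outer_ge0.
- by near=> k; apply: lee_sum => i _; exact: (PG i).2.
Unshelve. all: by end_near. Qed.

HB.instance Definition _ := isOuterMeasure.Build R 'rV[R]_n.+1 lebesgue_outer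
  lebesgue_outer0 lebesgue_outer_ge0 le_lebesgue_outer
  lebesgue_outer_sigma_subadditive.

End lebesgue_outer_measure.

(* From now on `measurable` on 'rV[R]_n.+1 means Lebesgue measurable. *)
HB.instance Definition _ (R : realType) (n : nat) :=
  Measurable.copy 'rV[R]_n.+1 (caratheodory_type (@lebesgue_outer R n)).

Definition leb {R : realType} {n : nat} : {measure set 'rV[R]_n.+1 -> \bar R} :=
  let mu : {outer_measure set 'rV[R]_n.+1 -> \bar R} := @lebesgue_outer R n in
  (mu : set (caratheodory_type mu) -> \bar R).

Section linear_algebra.
Context {R : realType} {n : nat}.
Implicit Types (xi eta : 'rV[R]_n) (M S : 'M[R]_n).

Definition dotp xi eta : R := \sum_i xi ord0 i * eta ord0 i.

(* The library norm on 'rV[R]_n is the sup norm; this is the Euclidean one. *)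
Definition enorm xi : R := Num.sqrt (dotp xi xi).

(* A matrix acting on (row) vectors as on columns. *)
Definition appmx M xi : 'rV[R]_n := (M *m xi^T)^T.

Definition nonneg_sym M : Prop :=
  M^T = M /\ forall xi, 0 <= dotp xi (appmx M xi).

(* The square root of a nonnegative definite symmetric matrix exists and is
   unique; the default value 0 is for the other matrices. *)
Definition sqrtmx M : 'M[R]_n :=
  xget 0 [set S | nonneg_sym S /\ S *m S = M].

Definition opnorm M : R :=
  sup [set enorm (appmx M xi) | xi in [set xi | enorm xi <= 1]].

End linear_algebra.

Section function_spaces.
Context {R : realType} {n : nat}.
Local Notation Rn := ('rV[R]_n.+1).
Implicit Types (Omega : set Rn) (v : Rn -> R) (Q : Rn -> 'M[R]_n.+1).

(* Functions on Omega are represented by functions on R^n, of which only the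
   restriction to Omega is used. *)

Definition bounded_domain Omega : Prop :=
  [/\ open Omega, connected Omega, Omega !=set0 & bounded_set Omega].

Definition weight Omega v : Prop :=
  measurable_fun Omega v /\ forall x, Omega x -> 0 <= v x.

Definition measurable_vfun Omega (t : Rn -> Rn) : Prop :=
  forall i, measurable_fun Omega (fun x => t x ord0 i).

Definition measurable_mxfun Omega Q : Prop :=
  forall i j, measurable_fun Omega (fun x => Q x i j).

Definition grad (phi : Rn -> R) (x : Rn) : Rn :=
  \row_i 'D_(delta_mx ord0 i) phi x.

Definition lip0 Omega (phi : Rn -> R) : Prop :=
  (forall x, Omega x ->
     exists2 U, nbhs x U & [lipschitz phi y | y in U]) /\
  (compact (closure [set x | phi x != 0]) /\
   closure [set x | phi x != 0] `<=` Omega).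

Definition Lp_norm v Omega (p : R) (h : Rn -> R) : \bar R :=
  poweR (\int[leb]_(x in Omega) (`|h x| `^ p * v x)%:E) p^-1.

Definition Lp_space v Omega (p : R) (h : Rn -> R) : Prop :=
  measurable_fun Omega h /\ (Lp_norm v Omega p h < +oo)%E.

Definition Orlicz_norm (Phi : R -> R) v Omega (h : Rn -> R) : \bar R :=
  ereal_inf [set l%:E | l in [set l : R | 0 < l /\
    (\int[leb]_(x in Omega) (Phi (`|h x| / l) * v x)%:E <= 1)%E]].

Definition Orlicz_space (Phi : R -> R) v Omega (h : Rn -> R) : Prop :=
  measurable_fun Omega h /\ (Orlicz_norm Phi v Omega h < +oo)%E.

Definition QLp_norm Q Omega (p : R) (G : Rn -> Rn) : \bar R :=
  poweR (\int[leb]_(x in Omega) (enorm (appmx (sqrtmx (Q x)) (G x)) `^ p)%:E)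
        p^-1.

Definition QLp_space Q Omega (p : R) (G : Rn -> Rn) : Prop :=
  measurable_vfun Omega G /\ (QLp_norm Q Omega p G < +oo)%E.

(* The pair (u, G), where G plays the role of "grad u", represents an element
   of QH^{1,p}_0(v, Omega). *)
Definition QH1p0 v Q Omega (p : R) (u : Rn -> R) (G : Rn -> Rn) : Prop :=
  [/\ Lp_space v Omega p u, QLp_space Q Omega p G &
      exists psi : nat -> Rn -> R,
        [/\ forall j, lip0 Omega (psi j),
            (fun j => Lp_norm v Omega p (fun x => psi j x - u x)) @ \oo
              --> 0%E &
            (fun j => QLp_norm Q Omega p (fun x => grad (psi j) x - G x)) @ \oo
              --> 0%E]].

Definition subunit v Q Omega (p : R) (t : Rn -> Rn) (Ct : R) : Prop :=
  forall phi, lip0 Omega phi ->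
    (Lp_norm v Omega p (fun x => dotp (t x) (grad phi x))
     <= Ct%:E * QLp_norm Q Omega p (grad phi))%E.

Definition Sobolev v Q Omega (p : R) (N : R -> R) (SN : R) : Prop :=
  forall phi, lip0 Omega phi ->
    (Orlicz_norm N v Omega phi <= SN%:E * QLp_norm Q Omega p (grad phi))%E.

(* When p < 2, the convention that |w|^{p-2} w vanishes where w = 0 holds since the factor w
   does (and sqrt(Q) G = 0 implies Q G = 0). *)
Definition weak_lhs Q Omega (p : R) (G : Rn -> Rn) (phi : Rn -> R) : \bar R :=
  \int[leb]_(x in Omega)
    (enorm (appmx (sqrtmx (Q x)) (G x)) `^ (p - 2) *
     dotp (grad phi x) (appmx (Q x) (G x)))%:E.

Definition weak_rhs v Omega (p : R) (t : Rn -> Rn) (f g : Rn -> R)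
    (phi : Rn -> R) : \bar R :=
  \int[leb]_(x in Omega)
    ((f x * `|f x| `^ (p - 2) * phi x +
      `|g x| `^ (p - 2) * g x * dotp (t x) (grad phi x)) * v x)%:E.

Definition weak_solution v Q Omega (p : R) t f g
    (u : Rn -> R) (G : Rn -> Rn) : Prop :=
  QH1p0 v Q Omega p u G /\
  forall phi, lip0 Omega phi ->
    weak_lhs Q Omega p G phi = weak_rhs v Omega p t f g phi.

Definition weak_subsolution v Q Omega (p : R) t f g
    (u : Rn -> R) (G : Rn -> Rn) : Prop :=
  QH1p0 v Q Omega p u G /\
  forall phi, lip0 Omega phi -> (forall x, Omega x -> 0 <= phi x) ->
    (weak_lhs Q Omega p G phi <= weak_rhs v Omega p t f g phi)%E.

Definition weak_supersolution v Q Omega (p : R) t f g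
    (u : Rn -> R) (G : Rn -> Rn) : Prop :=
  QH1p0 v Q Omega p u G /\
  forall phi, lip0 Omega phi -> (forall x, Omega x -> 0 <= phi x) ->
    (weak_rhs v Omega p t f g phi <= weak_lhs Q Omega p G phi)%E.

End function_spaces.

Section young_functions.
Context {R : realType}.

Definition conj_exp (sigma : R) : R := sigma / (sigma - 1).

Definition young_N (sigma p t : R) : R := t `^ (sigma * p).

Definition young_A (sigma p t : R) : R :=
  t `^ (conj_exp sigma * (p - 1)) *
  ln (expR 1 + t) `^ (conj_exp sigma * (p - 1)).

Definition young_B (sigma p t : R) : R :=
  t `^ (p * conj_exp sigma) * ln (expR 1 + t) `^ (p * conj_exp sigma).

Definition young_H (r t : R) : R := t `^ r * expR t.

End young_functions.

(* Main.v *)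
Require Import Defs.
From HB Require Import structures.
From mathcomp Require Import all_boot all_order all_algebra.
From mathcomp Require Import all_classical all_reals all_analysis.
From mathcomp Require Import measurable_realfun complex.
From mathcomp Require Import ring lra.

Set Implicit Arguments.
Unset Strict Implicit.
Unset Printing Implicit Defensive.

Import Order.TTheory GRing.Theory Num.Theory.
Import numFieldNormedType.Exports.

Local Open Scope classical_set_scope.
Local Open Scope ring_scope.

(* Test the inequality with phi = eta(psi_j), where psi_j approximates u, Theta' = theta
   is the truncation at height M of a (exp (a s^+) - 1), and eta' = theta^p.  Young's
   inequality and the subunit bound (applied to Theta(psi_j)) give, up to an error which
   vanishes with grad psi_j - grad u,
     int |theta(psi_j) sqrt(Q) grad psi_j|^p
       <= C int (|f|^(p-1) eta(psi_j) + |g|^p theta(psi_j)^p) v.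
   Since theta <= 2 a (1 + Theta), Hoelder's inequality with exponents sigma', sigma and
   the Sobolev inequality bound the right-hand side by C a^(p-1) times the left-hand side
   plus a constant, as soon as |f|^(p-1) and |g|^p are in L^(sigma').
   For a small, the left-hand side is absorbed, and int exp (a p sigma u^+) v
   is bounded after letting j and then M tend to infinity.
   As eta o psi has a partial derivative wherever psi has one, and the junk value of a
   missing partial derivative is 0, the chain rule holds everywhere and Rademacher's
   theorem is avoided. *)

(** * Square roots of nonnegative matrices *)

(** The gradient of u is only the second component of a limit of pairs, so there is no chain rule
    for u: all compositions are made with psi_j, while the equation still contains G = grad u. Each
    psi_j thus satisfies the energy inequality only up to an error, and the energy estimate is
    proved for the mixed quantities sqrt(Q) G and sqrt(Q) grad psi_j.

    The parameter a is chosen from p, the subunit constant, the Sobolev constant and int v alone,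
    before Q, f, g and u; this gives the stated dependence of C. It requires normalized data, which
    homogeneity provides: for l > ||f|| + ||g||, the function u / l solves the problem with data f /
    l and g / l, and l then decreases to ||f|| + ||g||. Taking l strictly larger also covers f = g =
    0.

    Subsolutions and opposites of supersolutions enter through one inequality, with absolute values
    on the right-hand side, so a single argument bounds u^+ and u^-. The final integrals are made at
    most 1/2 rather than 1: since u^+ and u^- are never both nonzero, the two bounds add up to the
    one for |u|, with the same constant. *)

Section sqrt_matrix.
Context {R : realType} {n : nat}.
Implicit Types (xi eta : 'rV[R]_n) (M S : 'M[R]_n).

Lemma dotpC xi eta : dotp xi eta = dotp eta xi.
Proof. by apply: eq_bigr => i _; rewrite mulrC. Qed.

Lemma dotpDl xi eta zeta : dotp (xi + eta) zeta = dotp xi zeta + dotp eta zeta.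
Proof. by rewrite -big_split; apply: eq_bigr => i _; rewrite mxE mulrDl. Qed.

Lemma dotpZl c xi eta : dotp (c *: xi) eta = c * dotp xi eta.
Proof. by rewrite /dotp mulr_sumr; apply: eq_bigr => i _; rewrite mxE mulrA. Qed.

Lemma dotpDr xi eta zeta : dotp zeta (xi + eta) = dotp zeta xi + dotp zeta eta.
Proof. by rewrite dotpC dotpDl !(dotpC zeta). Qed.

Lemma dotpZr c xi eta : dotp xi (c *: eta) = c * dotp xi eta.
Proof. by rewrite dotpC dotpZl (dotpC xi). Qed.

Lemma dotp_ge0 xi : 0 <= dotp xi xi.
Proof. by apply: sumr_ge0 => i _; rewrite -expr2 sqr_ge0. Qed.

Lemma dotp_eq0 xi : (dotp xi xi == 0) = (xi == 0).
Proof.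
apply/idP/eqP => [|->]; last by rewrite /dotp big1 // => i _; rewrite mxE mul0r.
rewrite psumr_eq0 => [/allP xi0|i _]; last by rewrite -expr2 sqr_ge0.
apply/rowP => i; rewrite !mxE.
by have := xi0 i (mem_index_enum i); rewrite /= -expr2 sqrf_eq0 => /eqP.
Qed.

Lemma dotp_mul xi eta : dotp xi eta = (xi *m eta^T) ord0 ord0.
Proof. by rewrite mxE; apply: eq_bigr => i _; rewrite mxE. Qed.

Lemma dotp_appmx xi eta M : dotp xi (appmx M eta) = dotp (appmx M^T xi) eta.
Proof. by rewrite !dotp_mul /appmx !trmxK trmx_mul !trmxK mulmxA. Qed.

End sqrt_matrix.

(** Newton interpolation: the correction added for a new node is a multiple of a polynomial
    vanishing at the old ones. It turns a function of the eigenvalues into a polynomial in the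
    matrix, which remains real and symmetric even though the diagonalization is complex. *)
Lemma poly_interpolation (F : fieldType) (c : F -> F) (s : seq F) :
  exists q : {poly F}, {in s, forall x, q.[x] = c x}.
Proof.
elim: s => [|x s [q qc]]; first by exists 0.
have [xs|xs] := boolP (x \in s).
  by exists q => y; rewrite inE => /predU1P[->|]; exact: qc.
pose w := \prod_(y <- s) ('X - y%:P).
exists (q + ((c x - q.[x]) / w.[x]) *: w) => y; rewrite inE => /predU1P[->|ys].
  rewrite hornerD hornerZ divfK ?subrKC// horner_prod.
  rewrite prodf_seq_neq0; apply/allP => z zs /=.
  by rewrite hornerXsubC subr_eq0; apply: contraNneq xs => ->.
have /rootP wy : root w y by rewrite root_prod_XsubC.
by rewrite hornerD hornerZ wy mulr0 addr0 qc.
Qed.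

Lemma trmx_horner (F : comNzRingType) (n : nat) (A : 'M[F]_n.+1) (q : {poly F}) :
  A^T = A -> (horner_mx A q)^T = horner_mx A q.
Proof.
move=> AT; have AX k : (A ^+ k)^T = A ^+ k.
  elim: k => [|k IH]; first by rewrite expr0 trmx1.
  by rewrite exprSr trmx_mul AT IH -[LHS]/(A * A ^+ k) -exprS exprSr.
elim/poly_ind: q => [|q c IH]; first by rewrite rmorph0 trmx0.
rewrite rmorphD rmorphM /= horner_mx_X horner_mx_C.
rewrite raddfD /= tr_scalar_mx trmx_mul AT IH; congr (_ + _).
exact: comm_mx_horner.
Qed.

Section spectral_real.
Context {R : realType} {n : nat}.
Local Notation toC := (real_complex R).
Variable M : 'M[R]_n.+1.
Hypothesis Mpsd : nonneg_sym M.
Let A := map_mx toC M.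
Let P := spectralmx A.
Let sp := spectral_diag A.

Let A_real : A \is a mxOver Num.real.
Proof. by apply/mxOverP => i j; rewrite mxE; apply/complex_realP; exists (M i j). Qed.

Let A_sym : A \is symmetricmx.
Proof.
apply/is_hermitianmxP; rewrite expr0 scale1r map_mx_id//.
by rewrite /A map_trmx Mpsd.1.
Qed.

Let A_spectral : A = invmx P *m diag_mx sp *m P.
Proof. exact/orthomx_spectralP/symmetric_normalmx. Qed.

Let PA : P *m A = diag_mx sp *m P.
Proof. by rewrite [in LHS]A_spectral !mulmxA mulmxV ?mul1mx// spectral_unit. Qed.

(** The eigenvalues are real because the complexified matrix is Hermitian. They are nonnegative
    because each one has a real eigenvector x, for which the quadratic form is d |x|^2. *)
Lemma psd_spectrum :
  exists2 d : 'rV[R]_n.+1, sp = map_mx toC d & forall i, 0 <= d ord0 i.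
Proof.
have spR : sp \is a mxOver Num.real.
  exact/hermitian_spectral_diag_real/realsym_hermsym.
exists (map_mx (@complex.Re R) sp).
  apply/matrixP => i j; rewrite 2!mxE RRe_real//; exact: (mxOverP spR).
move=> i; rewrite mxE; set d := complex.Re _.
have spd : sp ord0 i = toC d by rewrite RRe_real//; exact: (mxOverP spR).
have eA : eigenvalue A (sp ord0 i).
  apply/eigenvalueP; exists (row i P).
    rewrite -row_mul PA; apply/rowP => j; rewrite !mxE (bigD1 i)//= big1 => [|k ki].
      by rewrite mxE eqxx mulr1n addr0.
    by rewrite mxE eq_sym (negbTE ki) mulr0n mul0r.
  (* A zero row would contradict the invertibility of [P]. *)
  apply/eqP => Pi0.
  have : delta_mx ord0 i *m P *m invmx P = 0 :> 'rV_n.+1.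
    by rewrite -rowE Pi0 mul0mx.
  rewrite -mulmxA mulmxV ?spectral_unit// mulmx1 => /matrixP/(_ ord0 i).
  by rewrite !mxE !eqxx /= => /eqP; rewrite oner_eq0.
(* The descent from complex to real eigenvectors goes through the characteristic polynomial, whose
   root d is real. *)
have : eigenvalue M d.
  rewrite eigenvalue_root_char -(fmorph_root toC) map_char_poly.
  by move: eA; rewrite eigenvalue_root_char spd.
move=> /eigenvalueP[x xM x0].
have := Mpsd.2 x; rewrite /appmx trmx_mul trmxK Mpsd.1 xM dotpZr.
by rewrite pmulr_lge0// lt_neqAle eq_sym dotp_eq0 x0 dotp_ge0.
Qed.

(** The root is T^2, where T = q(M) and q interpolates the fourth root on the spectrum. Taking a
    square of a symmetric matrix makes nonnegativity immediate, as xi . T^2 xi = |T xi|^2. *)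
Lemma sqrtmx_exists : exists S, nonneg_sym S /\ S *m S = M.
Proof.
have [d spE d0] := psd_spectrum.
have [q qE] := poly_interpolation (fun x => Num.sqrt (Num.sqrt x))
  [seq d ord0 i | i <- enum 'I_n.+1].
pose T := horner_mx M q.
have TT : T^T = T by apply: trmx_horner; exact: Mpsd.1.
exists (T *m T); split; [split|].
- by rewrite trmx_mul TT.
- move=> xi; suff -> : appmx (T *m T) xi = appmx T (appmx T xi).
    by rewrite dotp_appmx TT dotp_ge0.
  by rewrite /appmx trmxK mulmxA.
(* T^4 = M is checked after complexification, where the polynomial q^4 - X acts on the diagonal form
   and vanishes at every eigenvalue. *)
suff : horner_mx M (q ^+ 4 - 'X) = 0.
  rewrite rmorphB rmorphXn /= horner_mx_X => /eqP; rewrite subr_eq0 => /eqP <-.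
  by rewrite -/T (exprD T 2 2) expr2.
apply: (@map_mx_inj _ _ toC); rewrite map_mx0.
rewrite map_horner_mx -/A A_spectral.
rewrite (horner_mx_uconjC _ _ (spectral_unit A)).
have -> : horner_mx (diag_mx sp) (map_poly toC (q ^+ 4 - 'X)) = 0.
  rewrite horner_mx_diag spE -map_mx_comp.
  have -> : map_mx (horner (map_poly toC (q ^+ 4 - 'X)) \o toC) d = 0.
    apply/rowP => i; rewrite !mxE /= horner_map.
    rewrite hornerD hornerN hornerX horner_exp qE; last by apply: map_f; rewrite mem_enum.
    by rewrite (exprM _ 2 2) !sqr_sqrtr ?sqrtr_ge0// subrr.
  by rewrite linear0.
by rewrite mulmx0 mul0mx.
Qed.

End spectral_real.

(** * Measurability for the Lebesgue measure *)

Lemma continuous_difference_quotient {R : realType} {V : normedModType R}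
    (f : V -> R) (h : R) (w : V) :
  continuous f -> continuous (fun x => h^-1 *: (f (h *: w + x) - f x)).
Proof.
move=> cf x; apply: cvgZl_tmp; apply: cvgB; last exact: cf.
apply: (@continuous_comp _ _ _ (fun x => h *: w + x) f); last exact: cf.
by apply: cvgD; [exact: cvg_cst|exact: cvg_id].
Qed.

Lemma continuous_distance {R : realType} {V : normedModType R} (f g : V -> R) :
  continuous f -> continuous g -> continuous (fun x => `|f x - g x|).
Proof. by move=> cf cg x; apply: cvg_norm; apply: cvgB; [exact: cf|exact: cg]. Qed.

Section lebesgue_measurable.
Context {R : realType} {n : nat}.
Local Notation Rn := ('rV[R]_n.+1).
Implicit Types (a b x : Rn) (i : 'I_n.+1) (c : R).

Let upd a i c : Rn := \row_j (if j == i then c else a ord0 j).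

(** The hyperplane x_i = c cuts a box into two boxes. The max and the min account for a hyperplane
    that misses the box: one piece then has a side of nonpositive length, hence volume 0. *)
Let box_volume_split a b i c :
  box_volume (upd a i (Num.max (a ord0 i) c)) b +
  box_volume a (upd b i (Num.min (b ord0 i) c)) = box_volume a b.
Proof.
have volE a' b' : box_volume a' b' = Num.max 0 (b' ord0 i - a' ord0 i) *
    \prod_(j | j != i) Num.max 0 (b' ord0 j - a' ord0 j).
  by rewrite /box_volume (bigD1 i).
have updE d j : j != i -> forall a', upd a' i d ord0 j = a' ord0 j.
  by move=> /negbTE ji a'; rewrite mxE ji.
rewrite !volE.
under [X in _ * X + _]eq_bigr => j ji do rewrite updE//.
under [X in _ + _ * X]eq_bigr => j ji do rewrite updE//.
rewrite -mulrDl !mxE eqxx; congr (_ * _).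
move: (a ord0 i) (b ord0 i) => s u.
have [sc|cs] := leP s c; have [uc|cu] := leP u c.
- by rewrite (max_l (_ : u - c <= 0)) ?add0r// subr_le0.
- rewrite (max_r (_ : 0 <= u - c)) ?subr_ge0 ?(ltW cu)//.
  rewrite (max_r (_ : 0 <= c - s)) ?subr_ge0//.
  rewrite (max_r (_ : 0 <= u - s)) ?subr_ge0 ?(le_trans sc (ltW cu))//; ring.
- have us : u - s <= 0 by rewrite subr_le0 (le_trans uc (ltW cs)).
  by rewrite !(max_l us) addr0.
- by rewrite (max_l (_ : c - s <= 0)) ?addr0// subr_le0 ltW.
Qed.

Let box_splitl a b i c :
  box a b `&` [set x | c < x ord0 i] `<=` box (upd a i (Num.max (a ord0 i) c)) b.
Proof.
move=> x [abx /= cx] j; rewrite mxE; case: eqP => [->|_]; last exact: abx.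
by have /andP[ax ->] := abx i; rewrite gt_max ax cx.
Qed.

Let box_splitr a b i c :
  box a b `&` ~` [set x | c < x ord0 i] `<=` box a (upd b i (Num.min (b ord0 i) c)).
Proof.
move=> x [abx /= /negP]; rewrite -leNgt => xc j; rewrite mxE.
case: eqP => [->|_]; last exact: abx.
by have /andP[-> xb] := abx i; rewrite le_min xb xc.
Qed.

(** Caratheodory's criterion: cutting every box of a cover of X along the hyperplane gives covers of
    the two parts of X with the same total volume. *)
Lemma measurable_halfspace i c : measurable [set x : Rn | c < x ord0 i].
Proof.
apply: (@le_caratheodory_measurable _ _ (@lebesgue_outer R n)) => X.
set H := [set _ | _].
suff : (lebesgue_outer (X `&` H) + lebesgue_outer (X `&` ~` H) <= lebesgue_outer X)%E by [].
apply: le_ereal_inf_tmp => _ [F XF <-].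
pose F1 k : Rn * Rn := (upd (F k).1 i (Num.max ((F k).1 ord0 i) c), (F k).2).
pose F2 k : Rn * Rn := ((F k).1, upd (F k).2 i (Num.min ((F k).2 ord0 i) c)).
have -> : (\sum_(k <oo) (box_volume (F k).1 (F k).2)%:E =
   \sum_(k <oo) (box_volume (F1 k).1 (F1 k).2)%:E +
   \sum_(k <oo) (box_volume (F2 k).1 (F2 k).2)%:E)%E.
  rewrite -nneseriesD; last 2 first.
    by move=> k _ _; rewrite lee_fin box_volume_ge0.
    by move=> k _ _; rewrite lee_fin box_volume_ge0.
  by apply: eq_eseriesr => k _; rewrite -EFinD box_volume_split.
apply: leeD; apply: ereal_inf_lbound; [exists F1|exists F2] => // x [Xx Hx].
  by have [k _ Fx] := XF x Xx; exists k => //; exact: box_splitl.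
by have [k _ Fx] := XF x Xx; exists k => //; exact: box_splitr.
Qed.

Lemma measurable_box a b : measurable (box a b).
Proof.
have -> : box a b = \bigcap_(i in [set: 'I_n.+1])
    ([set x : Rn | a ord0 i < x ord0 i] `&` ~` [set x : Rn | b ord0 i < x ord0 i]).
  apply/seteqP; split=> [x abx i _|x abx i].
    by have /andP[ax xb] := abx i; split => //=; apply/negP; rewrite -leNgt.
  by have [/= -> /negP] := abx i I; rewrite -leNgt => ->.
apply: fin_bigcap_measurable => // i _.
apply: measurableI; first exact: measurable_halfspace.
apply: measurableC; exact: measurable_halfspace.
Qed.

(* The sup-norm balls are cubes, so an open set is the union of the boxes with rational vertices that it contains. *)
Lemma open_measurable_rV (U : set Rn) : open U -> measurable U.
Proof.
move=> oU.
pose B (q : 'rV[rat]_n.+1 * 'rV[rat]_n.+1) : set Rn :=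
  box (map_mx ratr q.1) (map_mx ratr q.2).
have -> : U = \bigcup_q (if `[< B q `<=` U >] then B q else set0).
  apply/seteqP; split=> [x Ux|x [q _]]; last by case: asboolP => // qU /qU.
  have /nbhs_ballP[e /= e0 xeU] : nbhs x U by exact: open_nbhs_nbhs.
  have ql i : {q : rat | ratr q \in `]x ord0 i - e, x ord0 i[}.
    by apply/cid/rat_in_itvoo; rewrite gtrBl.
  have qr i : {q : rat | ratr q \in `]x ord0 i, x ord0 i + e[}.
    by apply/cid/rat_in_itvoo; rewrite ltrDl.
  exists (\row_i sval (ql i), \row_i sval (qr i)) => //.
  case: asboolP => [_|[]].
    move=> i; rewrite !mxE /=.
    case: (ql i) => /= s /andP[_]; rewrite bnd_simp => ->.
    by case: (qr i) => /= u /andP[]; rewrite bnd_simp => /ltW ->.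
  move=> y Bxy; apply: xeU; split => // j i; rewrite (ord1 j).
  have := Bxy i; rewrite !mxE /=.
  case: (ql i) => /= s /andP[+ _]; rewrite bnd_simp.
  case: (qr i) => /= u /andP[_]; rewrite bnd_simp.
  move=> ux xs /andP[sy yu]; rewrite /ball /= ltr_distlC.
  by rewrite (lt_trans xs sy) (le_lt_trans yu ux).
apply: countable_bigcupT_measurable => // q.
by case: ifP => // _; exact: measurable_box.
Qed.

Lemma closed_measurable_rV (U : set Rn) : closed U -> measurable U.
Proof.
by move=> cU; rewrite -(setCK U); apply/measurableC/open_measurable_rV; rewrite openC.
Qed.

Lemma continuous_measurable_rV (D : set Rn) (f : Rn -> R) :
  measurable D -> continuous f -> measurable_fun D f.
Proof.
move=> mD cf; apply: (measurability _ (RGenOpens.measurableE R)).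
move=> _ [_ [a [b ->] <-]]; apply: measurableI => //.
apply: open_measurable_rV; apply: open_comp => // x _; exact: cf.
Qed.

(** By the Cauchy criterion, f is differentiable along w exactly on [E]. For a given tolerance and
    radius the criterion is an intersection of closed conditions, so it is closed although h and h'
    range over an uncountable set. On [E] the derivative is a limit of a sequence of continuous
    quotients. *)
Lemma measurable_partial (D : set Rn) (f : Rn -> R) (w : Rn) :
  measurable D -> continuous f -> measurable_fun D (fun x => 'D_w f x).
Proof.
move=> mD cf.
pose q h x := h^-1 *: (f (h *: w + x) - f x).
have cq h : continuous (q h) by exact: continuous_difference_quotient.
pose C k m := [set x | forall h h', 0 < `|h| < m.+1%:R^-1 -> 0 < `|h'| < m.+1%:R^-1 ->
  `|q h x - q h' x| <= k.+1%:R^-1].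
have Cclosed k m : closed (C k m).
  have -> : C k m = \bigcap_(hh in [set hh : R * R | 0 < `|hh.1| < m.+1%:R^-1 /\
        0 < `|hh.2| < m.+1%:R^-1]) [set x | `|q hh.1 x - q hh.2 x| <= k.+1%:R^-1].
    apply/seteqP; split => x; first by move=> Cx [h h'] /= [hm h'm]; exact: Cx.
    by move=> Cx h h' hm h'm; exact: (Cx (h, h')).
  apply: closed_bigI => -[h h'] _ /=.
  apply: (@closed_comp _ _ (fun x => `|q h x - q h' x|) [set y | y <= _]).
    move=> x _; exact: continuous_distance.
  exact: closed_le.
pose E := \bigcap_k \bigcup_m C k m.
have mE : measurable E.
  apply: bigcapT_measurable => k; apply: bigcupT_measurable => m.
  exact: closed_measurable_rV.
have small m : \forall h \near (0:R)^', 0 < `|h| < m.+1%:R^-1.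
  near=> h; rewrite normr_gt0; apply/andP; split; first by near: h; exact: nbhs_dnbhs_neq.
  by near: h; apply: dnbhs0_lt; rewrite invr_gt0.
have dE x : derivable f x w <-> E x.
  split=> [/cvg_ex[l] ql k _|Ex].
    have /cvgr_dist_lt/(_ (k.+1%:R^-1 / 2)) := ql.
    rewrite divr_gt0 ?invr_gt0// => /(_ isT)[e /= e0 qe].
    have [m me] : exists m, m.+1%:R^-1 < e.
      by have [m _ me] := near_infty_natSinv_lt (PosNum e0); exists m; exact: (me m (leqnn m)).
    have Q h : 0 < `|h| < m.+1%:R^-1 -> `|l - q h x| < k.+1%:R^-1 / 2.
      move=> /andP[h0 hm]; apply: qe; last by rewrite -normr_gt0.
      by rewrite /= sub0r normrN (lt_trans hm).
    exists m => // h h' /Q hl /Q h'l.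
    rewrite -(subrKA l) (le_trans (ler_normD _ _))// (splitr k.+1%:R^-1).
    by rewrite lerD ?ltW// -normrN opprB.
  apply: cauchy_cvg; apply: cauchy_exP => e e0.
  have [k ke] : exists k, k.+1%:R^-1 < e.
    by have [m _ me] := near_infty_natSinv_lt (PosNum e0); exists m; exact: (me m (leqnn m)).
  have [m _ Cx] := Ex k I.
  exists (q (m.+1%:R^-1 / 2) x); apply: filterS (small m) => h hm.
  have m0 : 0 < m.+1%:R^-1 :> R by rewrite invr_gt0.
  have hC : `|q (m.+1%:R^-1 / 2) x - q h x| <= k.+1%:R^-1.
    apply: Cx => //.
    by rewrite gtr0_norm ?divr_gt0//= ltr_pdivrMr// ltr_pMr// ltr1n.
  by rewrite -ball_normE; exact: le_lt_trans hC ke.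
have mDE : measurable (D `&` E) by exact: measurableI.
have mDNE : measurable (D `&` ~` E) by apply: measurableI => //; exact: measurableC.
(* Outside [E] the quotient diverges and the derivative takes its default value 0. *)
have mf0 : measurable_fun (D `&` ~` E) (fun x => 'D_w f x).
  apply: (@eq_measurable_fun _ _ _ _ (D `&` ~` E) (fun=> 0 : R)).
    by move=> x; rewrite inE => -[_ Ex]; rewrite /derive dvgP// => /dE.
  exact: measurable_cst.
suff mf1 : measurable_fun (D `&` E) (fun x => 'D_w f x).
  suff -> : D = (D `&` E) `|` (D `&` ~` E) by apply/measurable_funU.
  by rewrite -setDE setUIDK.
apply: (@measurable_fun_cvg _ _ _ _ (fun m x => q m.+1%:R^-1 x)).
  by move=> m; apply: continuous_measurable_rV => //; exact: cq.
move=> x [_ /dE dx].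
suff hm : m.+1%:R^-1 @[m --> \oo] --> (0 : R)^' by exact: (cvg_comp _ _ hm dx).
move=> A /cvg_harmonic[N _ NA]; exists N => // m Nm /=.
by apply: NA => //; rewrite invr_eq0.
Unshelve. all: by end_near. Qed.
End lebesgue_measurable.

(** * Chain rule *)

Section chain_rule.
Context {R : realType} {V : normedModType R}.
Implicit Types (f psi : V -> R) (eta : R -> R).

(** The Lipschitz predicate only says that all sufficiently large constants work; this extracts a
    positive one. *)
Lemma lipschitz_bound f (A : set V) : [lipschitz f x | x in A] ->
  exists2 M, 0 < M & forall y z, A y -> A z -> `|f y - f z| <= M * `|y - z|.
Proof.
move=> [M0 [M0r HM]]; exists (Num.max M0 0 + 1).
  by rewrite ltr_wpDl// le_max lexx orbT.
move=> y z Ay Az; apply: (HM (Num.max M0 0 + 1) _ (y, z)) => //.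
by rewrite ltr_pwDr// le_max lexx.
Qed.

Lemma bound_lipschitz f (A : set V) (M : R) :
  (forall y z, A y -> A z -> `|f y - f z| <= M * `|y - z|) -> [lipschitz f x | x in A].
Proof.
move=> fM; exists M; split=> [|M' MM' [y z] [/= Ay Az]]; first exact: num_real.
by rewrite (le_trans (fM y z Ay Az))// ler_wpM2r// ltW.
Qed.

Lemma derive_approx eta (y d e : R) : is_derive y 1 eta d -> 0 < e ->
  \forall s \near 0, `|eta (s + y) - eta y - d * s| <= e * `|s|.
Proof.
move=> [deta <-] e0.
have /cvgr_dist_lt/(_ _ e0) [r /= r0 He] := deta.
exists r => //= s; rewrite /= sub0r normrN => sr.
have [->|s0] := eqVneq s 0; first by rewrite add0r subrr mulr0 subrr normr0 mulr0.
have := He s; rewrite /= sub0r normrN => /(_ sr s0) /ltW H.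
set D := 'D_1 eta y in H *.
have -> : eta (s + y) - eta y - D * s =
    - ((D - s^-1 * (eta (s * 1 + y) - eta y)) * s).
  by rewrite mulr1; field.
by rewrite normrN normrM ler_wpM2r.
Qed.

(* The derivative along w is 0 when the difference quotient has no limit, so the chain rule needs no differentiability of psi. *)
Lemma derive_comp_lipschitz psi eta (d : R) (x w : V) (U : set V) :
  nbhs x U -> [lipschitz psi y | y in U] -> is_derive (psi x) 1 eta d ->
  'D_w (eta \o psi) x = d * 'D_w psi x.
Proof.
move=> xU /lipschitz_bound[M M0 psiM] deta.
pose k h := psi (h *: w + x).
pose Q f h := h^-1 * (f (h *: w + x) - f x).
have Ux : U x by exact: nbhs_singleton.
have linx : h *: w + x @[h --> 0] --> x.
  rewrite -[X in _ --> X]add0r -(scale0r w).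
  by apply: cvgD; [apply: cvgZr_tmp; exact: cvg_id|exact: cvg_cst].
have kM : \forall h \near 0, `|k h - psi x| <= M * `|w| * `|h|.
  near=> h; have Uh : U (h *: w + x) by near: h; exact: linx.
  by rewrite (le_trans (psiM _ _ Uh Ux))// addrK normrZ (mulrC `|h|) mulrA.
have k0 : k h - psi x @[h --> 0] --> 0.
  apply/cvgr0Pnorm_le => e e0.
  have Mw0 : 0 < M * `|w| + 1 by rewrite ltr_wpDl// mulr_ge0// ltW.
  have small : \forall h \near (0 : R), `|h| <= (M * `|w| + 1)^-1 * e.
    by apply: (@nbhs0_le R R); rewrite mulr_gt0// invr_gt0.
  apply: filterS2 kM small => h hM; rewrite ler_pdivlMl//; apply: le_trans.
  by rewrite (le_trans hM)// ler_wpM2r// lerDl.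
(* The two quotients differ by o(1) whether or not they converge, because psi (h w + x) - psi x is
   O(h). *)
have D0 : Q (eta \o psi) h - d * Q psi h @[h --> 0^'] --> 0.
  apply/cvgr0Pnorm_le => c c0.
  have c'0 : 0 < c / (M * `|w| + 1).
    by rewrite divr_gt0// ltr_wpDl// mulr_ge0// ltW.
  have H : \forall h \near 0, `|eta (k h) - eta (psi x) - d * (k h - psi x)| <=
      c / (M * `|w| + 1) * `|k h - psi x|.
    have : \forall h \near 0, `|eta (k h - psi x + psi x) - eta (psi x) - d * (k h - psi x)| <=
        c / (M * `|w| + 1) * `|k h - psi x| by exact: (k0 _ (derive_approx deta c'0)).
    by apply: filterS => h; rewrite subrK.
  have h0 : \forall h \near 0^', h != 0 :> R by exact: nbhs_dnbhs_neq.
  move: (nbhs_dnbhs H) (nbhs_dnbhs kM) h0; apply: filterS3 => h {}H {}kM hn0.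
  have -> : Q (eta \o psi) h - d * Q psi h =
      h^-1 * (eta (k h) - eta (psi x) - d * (k h - psi x)).
    by rewrite /Q /k /=; ring.
  rewrite normrM normfV ler_pdivrMl ?normr_gt0//.
  apply: (le_trans H); apply: (le_trans (ler_wpM2l (ltW c'0) kM)).
  rewrite mulrA (mulrC `|h|) ler_wpM2r// mulrAC -mulrA ler_piMr ?(ltW c0)//.
  by rewrite ler_pdivrMr ?mul1r ?lerDl// ltr_wpDl// mulr_ge0// ltW.
have QE f : 'D_w f x = lim (Q f h @[h --> 0^']) by [].
have dE f : derivable f x w = cvg (Q f h @[h --> 0^']) by [].
have QeE : (fun h => Q (eta \o psi) h) =
   (fun h => (Q (eta \o psi) h - d * Q psi h) + d * Q psi h).
  by apply/funext => h; rewrite subrK.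
have [dpsi|ndpsi] := pselect (derivable psi x w).
  rewrite QE; apply: cvg_lim => //; rewrite QeE -[X in _ --> X]add0r.
  by apply: cvgD => //; apply: cvgMl_tmp; exact: dpsi.
rewrite [in RHS]/derive (dvgP ndpsi) mulr0.
(* With psi not derivable along w, both sides must be 0. If d = 0, the quotient of the composition
   tends to 0 by [D0]. *)
have [d0|dn0] := eqVneq d 0.
  rewrite QE; apply: cvg_lim => //; move: D0; rewrite d0.
  by under eq_fun do rewrite mul0r subr0.
(* If d is nonzero, the quotient of psi can be recovered from that of the composition, so neither
   converges and both derivatives are the default value. *)
suff ndc : ~ derivable (eta \o psi) x w by exact: dvgP ndc.
move=> dcomp; apply: ndpsi; rewrite dE.
have -> : (fun h => Q psi h) =
   (fun h => d^-1 * (Q (eta \o psi) h - (Q (eta \o psi) h - d * Q psi h))).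
  by apply/funext => h; rewrite subKr mulKf.
apply: is_cvgMl_tmp; apply: is_cvgB; last by apply/cvg_ex; exists 0.
exact: dcomp.
Unshelve. all: by end_near. Qed.

Lemma lipschitz_continuous_at psi (x : V) (U : set V) :
  nbhs x U -> [lipschitz psi y | y in U] -> {for x, continuous psi}.
Proof.
move=> xU /lipschitz_bound[M M0 psiM]; apply/cvgrPdist_le => e e0.
have H : \forall y \near x, `|x - y| <= e / M.
  by apply: cvgr_dist_le; [exact: cvg_id|rewrite divr_gt0].
have Ux := nbhs_singleton xU; apply: filterS2 xU H => y Uy xy.
rewrite (le_trans (psiM _ _ Ux Uy))//.
by rewrite mulrC -ler_pdivlMr.
Qed.

End chain_rule.

(** * Compactly supported Lipschitz functions and their compositions *)

Section lip0_composition.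
Context {R : realType} {n : nat}.
Local Notation Rn := ('rV[R]_n.+1).
Implicit Types (Omega : set Rn) (phi psi : Rn -> R) (eta : R -> R).

(** The Lipschitz condition is available only at points of Omega. Any other point has a
    neighbourhood where psi vanishes, since the support is closed and contained in Omega. *)
Lemma lip0_continuous Omega psi : lip0 Omega psi -> continuous psi.
Proof.
move=> [psiL [_ psiO]] x; have [Ox|Ox] := pselect (Omega x).
  have [U xU psiU] := psiL x Ox; exact: lipschitz_continuous_at psiU.
have Nx : ~ closure [set x | psi x != 0] x by move/psiO.
have oN : open (~` closure [set x | psi x != 0]) by rewrite openC; exact: closed_closure.
have N0 : nbhs x (~` closure [set x | psi x != 0]) by exact: open_nbhs_nbhs.
have psi0 y : (~` closure [set x | psi x != 0]) y -> psi y = 0.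
  by move=> Ny; apply/eqP/negP => /negP ?; apply: Ny; exact: subset_closure.
apply: (lipschitz_continuous_at N0); apply: (@bound_lipschitz _ _ _ _ 0) => y z Ny Nz.
by rewrite (psi0 y)// (psi0 z)// subrr normr0 mul0r.
Qed.

Lemma lip0_comp Omega psi eta (L : R) : lip0 Omega psi -> eta 0 = 0 ->
  (forall s s', `|eta s - eta s'| <= L * `|s - s'|) -> lip0 Omega (eta \o psi).
Proof.
move=> [psiL [psiK psiO]] eta0 etaL.
have sub : closure [set x | (eta \o psi) x != 0] `<=` closure [set x | psi x != 0].
  apply: closure_subset => x /=; apply: contra_neq => ->; exact: eta0.
split; [|split].
- move=> x Ox; have [U xU /lipschitz_bound[M M0 psiM]] := psiL x Ox.
  exists U => //; apply: (@bound_lipschitz _ _ _ _ (`|L| * M)) => y z Uy Uz.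
  rewrite (le_trans (etaL _ _))//.
  rewrite (le_trans (ler_wpM2r _ (ler_norm L)))// -mulrA.
  by rewrite ler_wpM2l// psiM.
- apply: (subclosed_compact _ psiK sub); exact: closed_closure.
- exact: subset_trans sub psiO.
Qed.

Lemma grad_comp Omega psi eta (deta : R -> R) x : lip0 Omega psi -> Omega x ->
  (forall s : R, is_derive s 1 eta (deta s)) ->
  grad (eta \o psi) x = deta (psi x) *: grad psi x.
Proof.
move=> [psiL _] Ox he; have [U xU psiU] := psiL x Ox.
by apply/rowP => i; rewrite !mxE; exact: (derive_comp_lipschitz _ xU psiU).
Qed.

End lip0_composition.

(** * Power inequalities *)

Section power_inequalities.
Context {R : realType}.
Implicit Types a b d ip x z p q K : R.

Lemma powRD1 q x : q + 1 != 0 -> 0 <= x -> x `^ q * x = x `^ (q + 1).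
Proof.
move=> q1 x0; have [->|xn0] := eqVneq x 0; first by rewrite mulr0 powR0.
by rewrite -[X in _ * X]powRr1// -powRD ?xn0 ?implybT.
Qed.

Lemma powRB1 p x : 0 < p -> 0 <= x -> x `^ (p - 1) * x = x `^ p.
Proof. by move=> p0 x0; rewrite powRD1 ?subrK// gt_eqF. Qed.

Lemma le_powR2 p x z : 0 <= p -> 0 <= x -> x <= z -> x `^ p <= z `^ p.
Proof. by move=> p0 x0 xz; rewrite ge0_ler_powR// nnegrE// (le_trans x0). Qed.

Lemma powRD_le p x z : 0 <= p -> 0 <= x -> 0 <= z ->
  (x + z) `^ p <= 2 `^ p * (x `^ p + z `^ p).
Proof.
move=> p0 x0 z0; wlog xz : x z x0 z0 / x <= z.
  by move=> H; have [/H|/ltW/H] := leP x z; [exact|rewrite addrC (addrC (x `^ p)); exact].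
apply: (@le_trans _ _ ((2 * z) `^ p)).
  by apply: le_powR2 => //; [rewrite addr_ge0|lra].
by rewrite powRM// ler_wpM2l ?powR_ge0// lerDr powR_ge0.
Qed.

(** Comparing z with K x: the first term dominates when z <= K x, the second one otherwise. The free
    weight K makes the coefficient of z^p as small as needed. *)
Lemma weighted_young p K x z : 1 < p -> 0 < K -> 0 <= x -> 0 <= z ->
  x `^ (p - 1) * z <= K * x `^ p + K `^ (1 - p) * z `^ p.
Proof.
move=> p1 K0 x0 z0; have p0 : 0 < p by rewrite (lt_trans _ p1).
have [zK|/ltW Kz] := leP z (K * x).
  rewrite -[leLHS]addr0 lerD ?mulr_ge0 ?powR_ge0//.
  rewrite -(powRB1 p0 x0) mulrCA ler_wpM2l ?powR_ge0//.
rewrite -[leLHS]add0r lerD ?mulr_ge0 ?powR_ge0// ?(ltW K0)//.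
have -> : K `^ (1 - p) * z `^ p = (z / K) `^ (p - 1) * z.
  rewrite -(powRB1 p0 z0) mulrA; congr (_ * _).
  rewrite powRM ?invr_ge0 ?(ltW K0)// mulrC; congr (_ * _).
  by rewrite -powR_inv1 ?(ltW K0)// -powRrM mulN1r opprB.
rewrite ler_wpM2r//; apply: le_powR2 => //; first by rewrite subr_ge0 ltW.
by rewrite ler_pdivlMr// mulrC.
Qed.

Lemma young_add p x z : 1 < p -> 0 <= x -> 0 <= z ->
  x `^ (p - 1) * z <= x `^ p + z `^ p.
Proof.
by move=> p1 x0 z0; have := weighted_young p1 ltr01 x0 z0; rewrite powR1 !mul1r.
Qed.

(* If 2 d <= a, then ip >= a^2 / 2; otherwise both a and b are at most 3 d. *)
Lemma energy_perturbation p a b d ip : 1 < p -> 0 <= a -> 0 <= b -> 0 <= d ->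
  `|ip| <= a * b -> b <= a + d -> a ^+ 2 - a * d <= ip ->
  b `^ p <= 2 `^ (p + 1) * (a `^ (p - 2) * ip) +
            (2 `^ (p + 1) + 1) * 3 `^ p * d `^ p.
Proof.
move=> p1 a0 b0 d0 ipab bad aip; have p0 : 0 < p by rewrite (lt_trans _ p1).
have p2 : (p - 2 + 1 = p - 1) by lra.
have p2n : p - 2 + 1 != 0 by rewrite p2 subr_eq0 gt_eqF.
have c0 : 0 <= 2 `^ (p + 1) :> R by exact: powR_ge0.
have [da|ad] := leP (2 * d) a.
  rewrite -[leLHS]addr0 lerD ?mulr_ge0 ?powR_ge0 ?addr_ge0//.
  have H : a `^ p / 2 <= a `^ (p - 2) * ip.
    rewrite -(powRB1 p0 a0) -p2 -(powRD1 p2n a0) -!mulrA ler_wpM2l ?powR_ge0//.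
    by apply: le_trans aip; rewrite expr2; nra.
  apply: (@le_trans _ _ (2 `^ (p + 1) * (a `^ p / 2))); last by rewrite ler_wpM2l.
  rewrite powRD ?pnatr_eq0 ?implybT// powRr1//.
  have -> : 2 `^ p * 2 * (a `^ p / 2) = (2 * a) `^ p :> R by rewrite powRM//; field.
  by apply: le_powR2 => //; [exact: ltW|lra].
have b3 : b `^ p <= 3 `^ p * d `^ p.
  by rewrite -powRM//; apply: le_powR2 => //; [exact: ltW|lra].
(* Here [ip] may be negative, so the first term of the claim is bounded below by minus an error.
   This is the origin of the coefficient 2^(p+1) + 1: the 1 is for b^p, the rest for this term. *)
have ipd : a `^ (p - 2) * `|ip| <= 3 `^ p * d `^ p.
  apply: (@le_trans _ _ (a `^ (p - 2) * (a * b))); first by rewrite ler_wpM2l ?powR_ge0.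
  rewrite mulrA powRD1// p2 -powRM// -(powRB1 p0 (_ : 0 <= 3 * d)); last by rewrite mulr_ge0.
  rewrite ler_pM ?powR_ge0//; last lra.
  by apply: le_powR2 => //; [rewrite subr_ge0 ltW|lra].
have Nip : - (a `^ (p - 2) * `|ip|) <= a `^ (p - 2) * ip.
  by rewrite -mulrN ler_wpM2l ?powR_ge0// lerNnormlW.
set A := 3 `^ p * d `^ p in b3 ipd; set B := a `^ (p - 2) * `|ip| in ipd Nip.
rewrite -mulrA -/A; set c := 2 `^ (p + 1) in c0 *; set D := _ * ip in Nip *.
nra.
Qed.

End power_inequalities.

(** * Test functions *)

Section antiderivative.
Context {R : realType}.
Implicit Types (f F : R -> R) (p : R).

(** Differentiability of the power applies only where f > 0. At a zero of f, smallness of f^p comes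
    from f <= e^(1/p) nearby. *)
Lemma continuous_powR_comp f p : 0 < p -> continuous f -> (forall s, 0 <= f s) ->
  continuous (fun s => f s `^ p).
Proof.
move=> p0 cf f0 s; have := f0 s; rewrite le_eqVlt => /predU1P[fs0|fs0].
  rewrite /continuous_at -fs0 powR0 ?gt_eqF//; apply/cvgr0Pnorm_le => e e0.
  have fs : f y @[y --> s] --> 0 by rewrite fs0; exact: cf.
  have := @cvgr0_norm_le _ R^o _ _ _ f fs (e `^ p^-1) (powR_gt0 _ e0).
  move=> /(_ _) fe; suff : \forall t \near s, `|f t `^ p| <= e by [].
  apply: filterS fe => y fy; rewrite ger0_norm ?powR_ge0//.
  have := fy; rewrite ger0_norm// => /(@ge0_ler_powR _ p (ltW p0)).
  by rewrite -powRrM mulVf ?gt_eqF// powRr1 ?(ltW e0)//; apply; rewrite nnegrE ?powR_ge0.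
apply: (@continuous_comp _ _ _ f (fun y => y `^ p)); first exact: cf.
apply/differentiable_continuous/derivable1_diffP.
by apply: derivable_powR; rewrite in_itv/= fs0.
Qed.

Lemma continuous_clamp (M : R) : continuous (fun s : R => Num.min (Num.max s 0) M).
Proof.
have cmax (f g : R -> R) : continuous f -> continuous g ->
    continuous (fun s => Num.max (f s) (g s)).
  move=> cf cg.
  have -> : (fun s => Num.max (f s) (g s)) = (fun s => (f s + g s + `|f s - g s|) / 2).
    by apply/funext => s; exact: maxr_absE.
  move=> s; apply: cvgMr_tmp; apply: cvgD.
    by apply: cvgD; [exact: cf|exact: cg].
  by apply: cvg_norm; apply: cvgB; [exact: cf|exact: cg].
have -> : (fun s : R => Num.min (Num.max s 0) M) =
    (fun s => - Num.max (- Num.max s 0) (- M)).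
  by apply/funext => s; rewrite oppr_max !opprK.
have c0 : continuous (fun s : R => - Num.max s 0).
  by move=> s; apply: cvgN; apply: (cmax id (fun=> 0)) => {}s; [exact: cvg_id|exact: cvg_cst].
by move=> s; apply: cvgN; apply: (cmax _ (fun=> - M) c0) => {}s; exact: cvg_cst.
Qed.

Lemma antiderivative f : continuous f -> (forall s, s <= 0 -> f s = 0) ->
  exists2 F, forall s, s <= 0 -> F s = 0 & forall s : R, is_derive s 1 F (f s).
Proof.
move=> cf f0.
(* The base point -1 lies where f vanishes, so F is 0 up to 0, and every s >= 0 is interior to
   [-1, s + 1], as the fundamental theorem of calculus requires. *)
pose F s := \int[lebesgue_measure]_(x in `[-1 : R, s]) f x.
have F0 s : s <= 0 -> F s = 0.
  move=> s0; rewrite /F /Rintegral; under eq_integral.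
    move=> x; rewrite inE/= in_itv/= => /andP[_ xs]; rewrite f0 ?(le_trans xs)//.
    over.
  by rewrite integral0.
exists F => // s.
have [s0|s0] := ltP s 0.
  have near0 : \forall y \near s, F y = 0.
    by near=> y; apply: F0; apply/ltW; near: y; exact: lt_nbhsl.
  have d0 : is_derive s 1 (cst 0 : R -> R) (0 : R) := is_derive_cst (0 : R) s 1.
  rewrite f0 ?ltW//; apply: near_eq_is_derive d0.
  by apply: filterS near0 => y ->.
have s1 : s < s + 1 by rewrite ltrDl.
have [] := @continuous_FTC1_closed R f (-1) s (s + 1) s1.
- apply: continuous_compact_integrable; first exact: segment_compact.
  exact: continuous_subspaceT.
- by rewrite (lt_le_trans _ s0)// ltrN10.
- exact: cf.
- by move=> /derivableP dF; rewrite derive1E => <-; exact: dF.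
Unshelve. all: by end_near. Qed.

Lemma is_derive_continuous F f : (forall s : R, is_derive s 1 F (f s)) -> continuous F.
Proof.
by move=> dF s; apply/differentiable_continuous/derivable1_diffP; exact: ex_derive.
Qed.

Lemma mvt F f (a b : R) : (forall s : R, is_derive s 1 F (f s)) -> a <= b ->
  exists2 c, a <= c <= b & F b - F a = f c * (b - a).
Proof.
move=> dF ab; have [|c] := @MVT_segment R F f a b ab (fun s _ => dF s).
  by apply: continuous_subspaceT; exact: is_derive_continuous dF.
by rewrite in_itv/= => cab E; exists c.
Qed.

Lemma derive_lipschitz F f (L : R) : (forall s : R, is_derive s 1 F (f s)) ->
  (forall s, `|f s| <= L) -> forall s s', `|F s - F s'| <= L * `|s - s'|.
Proof.
move=> dF fL s s'; wlog ss' : s s' / s' <= s.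
  by move=> H; case: (leP s' s) => [|/ltW] /H// ; rewrite distrC (distrC s').
by have [c _ ->] := mvt dF ss'; rewrite normrM ler_wpM2r.
Qed.

Lemma derive_le F f G g (a b : R) : (forall s : R, is_derive s 1 F (f s)) ->
  (forall s : R, is_derive s 1 G (g s)) -> a <= b ->
  (forall s, a <= s <= b -> f s <= g s) -> F b - F a <= G b - G a.
Proof.
move=> dF dG ab fg.
have dFG (s : R) : is_derive s 1 (fun s => G s - F s) (g s - f s) by exact: is_deriveB.
have [c cab E] := mvt dFG ab; rewrite -subr_ge0.
have -> : G b - G a - (F b - F a) = G b - F b - (G a - F a) by ring.
by rewrite E mulr_ge0// subr_ge0// fg.
Qed.

End antiderivative.

(** * The truncated exponential and its two primitives *)

Section test_functions.
Context {R : realType}.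
Variables (al M p : R).
Hypotheses (al0 : 0 < al) (M0 : 0 <= M) (p1 : 1 < p).
Implicit Types s : R.

Definition clamp s : R := Num.min (Num.max s 0) M.
(** The primitive vanishing at 0 of al (exp (al s) - 1); it is what [Theta] becomes on [0, M]. *)
Definition expm1x s : R := expR (al * s) - 1 - al * s.
(** The theta of the overview. Subtracting 1 makes it continuous at 0, so its primitives are
    differentiable everywhere, as the chain rule needs; the truncation bounds it, so they are
    Lipschitz and their compositions with psi are admissible. *)
Definition slope s : R := al * (expR (al * clamp s) - 1).

Lemma clamp_ge0 s : 0 <= clamp s.
Proof. by rewrite le_min M0 le_max lexx orbT. Qed.

Lemma clamp_le s : clamp s <= M.
Proof. by rewrite ge_min lexx orbT. Qed.

Lemma clamp_npos s : s <= 0 -> clamp s = 0.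
Proof. by move=> s0; rewrite /clamp max_r// min_l. Qed.

Lemma clamp_id s : 0 <= s <= M -> clamp s = s.
Proof. by move=> /andP[s0 sM]; rewrite /clamp max_l// min_l. Qed.

Lemma clamp_leid s : 0 <= s -> clamp s <= s.
Proof. by move=> s0; rewrite /clamp max_l// ge_min lexx. Qed.

Lemma le_clamp s s' : s <= s' -> clamp s <= clamp s'.
Proof. by move=> ss'; rewrite le_min2// le_max2. Qed.

Lemma slope_continuous : continuous slope.
Proof.
move=> s; apply: cvgMl_tmp; apply: cvgB; last exact: cvg_cst.
apply: (@continuous_comp _ _ _ (fun s => al * clamp s) expR); last exact: continuous_expR.
by apply: cvgMl_tmp; exact: continuous_clamp.
Qed.

Lemma slope_ge0 s : 0 <= slope s.
Proof. by rewrite mulr_ge0 ?(ltW al0)// subr_ge0 -expR0 ler_expR mulr_ge0 ?(ltW al0)// clamp_ge0. Qed.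

Lemma slope_npos s : s <= 0 -> slope s = 0.
Proof. by move=> s0; rewrite /slope clamp_npos// mulr0 expR0 subrr mulr0. Qed.

Lemma le_slope s s' : s <= s' -> slope s <= slope s'.
Proof.
by move=> ss'; rewrite /slope ler_pM2l// lerB// ler_expR ler_pM2l// le_clamp.
Qed.

Lemma slope_le s : slope s <= al * (expR (al * M) - 1).
Proof. by rewrite /slope ler_pM2l// lerB// ler_expR ler_pM2l// clamp_le. Qed.

Lemma expm1x_ge0 s : 0 <= expm1x s.
Proof. by have := expR_ge1Dx (al * s); rewrite /expm1x; lra. Qed.

(* exp x = (exp (x/2))^2 >= (1 + x/2)^2 >= 2 x *)
Lemma expR_le_expm1x s : 0 <= s -> expR (al * s) <= 2 * (1 + expm1x s).
Proof.
move=> s0; have as0 : 0 <= al * s by rewrite mulr_ge0// ltW.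
suff : 2 * (al * s) <= expR (al * s) by rewrite /expm1x; lra.
have -> : expR (al * s) = expR (al * s / 2) ^+ 2.
  by rewrite expr2 -expRD; congr expR; lra.
have h := expR_ge1Dx (al * s / 2).
have : (1 + al * s / 2) ^+ 2 <= expR (al * s / 2) ^+ 2.
  by rewrite lerXn2r ?nnegrE ?expR_ge0// addr_ge0// divr_ge0.
have := sqr_ge0 (al * s / 2 - 1); nra.
Qed.

Lemma is_derive_expm1x s : is_derive s 1 expm1x (al * (expR (al * s) - 1)).
Proof.
rewrite /expm1x; apply: is_derive_eq.
by rewrite /GRing.scale /=; ring.
Qed.

(** All the bounds are comparisons of derivatives. For [Theta] from below, the comparison with
    [expm1x] is made on [0, clamp s], followed by monotonicity beyond M. *)
Lemma test_functions : exists Theta eta : R -> R,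
  [/\ forall s, is_derive s 1 Theta (slope s),
      forall s, is_derive s 1 eta (slope s `^ p),
      Theta 0 = 0 /\ eta 0 = 0,
      forall s, 0 <= eta s <= slope s `^ (p - 1) * Theta s &
      forall s, expm1x (clamp s) <= Theta s /\ slope s <= 2 * al * (1 + Theta s)].
Proof.
have p0 : 0 < p by rewrite (lt_trans _ p1).
have [Th Th0 dTh] := antiderivative slope_continuous slope_npos.
have [et et0 det] : exists2 F : R -> R, forall s, s <= 0 -> F s = 0 &
    forall s, is_derive s 1 F (slope s `^ p).
  apply: antiderivative => [|s s0].
    by apply: continuous_powR_comp => //; [exact: slope_continuous|exact: slope_ge0].
  by rewrite slope_npos// powR0// gt_eqF.
have Th00 := Th0 0 (lexx 0); have et00 := et0 0 (lexx 0).
have d0 (s : R) : is_derive s 1 (cst 0 : R -> R) (0 : R) := is_derive_cst (0 : R) s 1.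
have ThE s : expm1x (clamp s) <= Th s.
  have [s0|s0] := leP s 0.
    by rewrite clamp_npos// Th0// /expm1x mulr0 expR0 subrr subr0.
  apply: (@le_trans _ _ (Th (clamp s))).
    have := derive_le is_derive_expm1x dTh (clamp_ge0 s).
    have -> : expm1x 0 = 0 by rewrite /expm1x mulr0 expR0 subrr subr0.
    rewrite Th00 !subr0; apply => y /andP[y0 ys].
    by rewrite /slope clamp_id// y0 (le_trans ys)// clamp_le.
  have := derive_le d0 dTh (clamp_leid (ltW s0)).
  by rewrite subrr subr_ge0; apply => y _; exact: slope_ge0.
have Th_ge0 s : 0 <= Th s by rewrite (le_trans _ (ThE s))// expm1x_ge0.
exists Th, et; split => //.
- move=> s; have [s0|/ltW s0] := leP s 0.
    by rewrite et0// Th0// mulr0 lexx.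
  apply/andP; split.
    have := derive_le d0 det s0.
    by rewrite subrr et00 subr0; apply => y _; exact: powR_ge0.
  (* Since [slope] is nondecreasing, slope y^p <= slope s^(p-1) slope y on [0, s]: one factor is
     frozen at its largest value. *)
  have dTh' (y : R) : is_derive y 1 (fun y => slope s `^ (p - 1) * Th y)
      (slope s `^ (p - 1) * slope y).
    exact: (is_deriveZ (slope s `^ (p - 1)) (dTh y)).
  have := derive_le det dTh' s0.
  rewrite et00 Th00 mulr0 !subr0; apply => y /andP[y0 ys].
  rewrite -(powRB1 p0 (slope_ge0 y)).
  apply: (ler_wpM2r (slope_ge0 y)); apply: ge0_ler_powR.
  - by rewrite subr_ge0 ltW.
  - by rewrite nnegrE slope_ge0.
  - by rewrite nnegrE slope_ge0.
  - exact: le_slope.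
- move=> s; split => //; rewrite /slope.
  rewrite (mulrC 2) -mulrA ler_pM2l//.
  have := expR_le_expm1x (clamp_ge0 s); have := ThE s; lra.
Qed.

End test_functions.

(** * The energy estimate *)

Section real_integrals.
Context d (T : measurableType d) (R : realType) (mu : {measure set T -> \bar R}).
Variable D : set T.
Hypothesis mD : measurable D.
Implicit Types f g h v : T -> R.
Local Open Scope ereal_scope.

Definition rint f : \bar R := \int[mu]_(x in D) (f x)%:E.

Lemma rint_ge0 f : (forall x, D x -> 0 <= f x)%R -> 0 <= rint f.
Proof. by move=> f0; apply: integral_ge0 => x Dx; rewrite lee_fin f0. Qed.

Lemma le_rint f g : measurable_fun D f -> measurable_fun D g ->
  (forall x, D x -> 0 <= f x)%R -> (forall x, D x -> f x <= g x)%R ->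
  rint f <= rint g.
Proof.
move=> mf mg f0 fg.
have F0 x : D x -> 0 <= (f x)%:E by move=> Dx; rewrite lee_fin f0.
have FG x : D x -> (f x)%:E <= (g x)%:E by move=> Dx; rewrite lee_fin fg.
have mF : measurable_fun D (fun x => (f x)%:E) by exact/measurable_EFinP.
have mG : measurable_fun D (fun x => (g x)%:E) by exact/measurable_EFinP.
exact: (ge0_le_integral mu mD F0 mF mG FG).
Qed.

Lemma eq_rint f g : (forall x, D x -> f x = g x) -> rint f = rint g.
Proof. by move=> fg; apply: eq_integral => x; rewrite inE => Dx; rewrite fg. Qed.

Lemma rintD f g : measurable_fun D f -> measurable_fun D g ->
  (forall x, D x -> 0 <= f x)%R -> (forall x, D x -> 0 <= g x)%R ->
  rint (fun x => f x + g x)%R = rint f + rint g.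
Proof.
move=> mf mg f0 g0.
have F0 x : D x -> 0 <= (f x)%:E by move=> Dx; rewrite lee_fin f0.
have G0 x : D x -> 0 <= (g x)%:E by move=> Dx; rewrite lee_fin g0.
have mF : measurable_fun D (fun x => (f x)%:E) by exact/measurable_EFinP.
have mG : measurable_fun D (fun x => (g x)%:E) by exact/measurable_EFinP.
exact: (ge0_integralD mu mD F0 mF G0 mG).
Qed.

Lemma rintZ (c : R) f : (0 <= c)%R -> measurable_fun D f ->
  (forall x, D x -> 0 <= f x)%R -> rint (fun x => c * f x)%R = c%:E * rint f.
Proof.
move=> c0 mf f0.
have F0 x : D x -> 0 <= (f x)%:E by move=> Dx; rewrite lee_fin f0.
have mF : measurable_fun D (fun x => (f x)%:E) by exact/measurable_EFinP.
exact: (ge0_integralZl_EFin mu mD F0 mF c0).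
Qed.

Lemma le_rint_comb (a b : R) f g h :
  measurable_fun D f -> measurable_fun D g -> measurable_fun D h ->
  (0 <= a)%R -> (0 <= b)%R -> (forall x, D x -> 0 <= f x)%R ->
  (forall x, D x -> 0 <= g x)%R -> (forall x, D x -> 0 <= h x)%R ->
  (forall x, D x -> f x <= a * g x + b * h x)%R ->
  rint f <= a%:E * rint g + b%:E * rint h.
Proof.
move=> mf mg mh a0 b0 f0 g0 h0 fgh; rewrite -rintZ// -rintZ// -rintD//.
- by apply: le_rint => //; apply: measurable_funD; apply: measurable_funM.
- exact: measurable_funM.
- exact: measurable_funM.
- by move=> x Dx; rewrite mulr_ge0// g0.
- by move=> x Dx; rewrite mulr_ge0// h0.
Qed.

Lemma measurable_powR_comp (p : R) f : measurable_fun D f ->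
  measurable_fun D (fun x => f x `^ p)%R.
Proof. by move=> mf; apply: (measurableT_comp (measurable_powR p) mf). Qed.

(* Integrate Young's inequality, the weight W making both terms equal to W. *)
Lemma rint_hoelder (sigma W : R) f h v : (1 < sigma)%R -> (0 < W)%R ->
  measurable_fun D f -> measurable_fun D h -> measurable_fun D v ->
  (forall x, D x -> 0 <= f x)%R -> (forall x, D x -> 0 <= h x)%R ->
  (forall x, D x -> 0 <= v x)%R ->
  rint (fun x => f x `^ conj_exp sigma * v x)%R <= 1 ->
  rint (fun x => h x `^ sigma * v x)%R <= (W `^ sigma)%:E ->
  rint (fun x => f x * h x * v x)%R <= (2 * W)%:E.
Proof.
move=> s1 W0 mf mh mv f0 h0 v0 fI hI.
have s10 : (sigma - 1 != 0)%R by rewrite subr_eq0 gt_eqF.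
have H := @le_rint_comb W (W `^ (1 - sigma)) (fun x => f x * h x * v x)%R
  (fun x => f x `^ conj_exp sigma * v x)%R (fun x => h x `^ sigma * v x)%R.
apply: (le_trans (H _ _ _ _ _ _ _ _ _)).
- by apply: measurable_funM => //; apply: measurable_funM.
- by apply: measurable_funM => //; exact: measurable_powR_comp.
- by apply: measurable_funM => //; exact: measurable_powR_comp.
- exact: ltW.
- exact: powR_ge0.
- by move=> x Dx; rewrite !mulr_ge0 ?f0 ?h0 ?v0.
- by move=> x Dx; rewrite mulr_ge0 ?powR_ge0 ?v0.
- by move=> x Dx; rewrite mulr_ge0 ?powR_ge0 ?v0.
- move=> x Dx; rewrite !mulrA -mulrDl ler_wpM2r ?v0//.
  (* The inequality is applied to f^(1/(sigma-1)), whose power sigma is f to the conjugate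
     exponent. *)
  have := @weighted_young R sigma W (f x `^ (sigma - 1)^-1) (h x) s1 W0 (powR_ge0 _ _) (h0 x Dx).
  by rewrite -!powRrM mulVf// powRr1 ?f0// [((sigma - 1)^-1 * sigma)%R]mulrC.
apply: (@le_trans _ _ (W%:E * 1 + (W `^ (1 - sigma))%:E * (W `^ sigma)%:E)).
  by apply: leeD; apply: lee_wpmul2l => //; rewrite lee_fin ?powR_ge0 ?(ltW W0).
rewrite mule1 -EFinM -EFinD lee_fin -powRD ?(gt_eqF W0) ?implybT// subrK.
by rewrite powRr1 ?(ltW W0)//; lra.
Qed.

Local Close Scope ereal_scope.

Lemma EFin_mul_lty (c : R) (x : \bar R) :
  0 <= c -> (0 <= x)%E -> (x < +oo)%E -> (c%:E * x < +oo)%E.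
Proof. by move=> c0 x0 xoo; rewrite lte_mul_pinfty. Qed.

Lemma integrable_le (f g : T -> R) : measurable_fun D f -> measurable_fun D g ->
  (forall x, D x -> `|f x| <= g x) -> (rint g < +oo)%E ->
  mu.-integrable D (EFin \o f).
Proof.
move=> mf mg fg gI; apply/integrableP; split; first exact/measurable_EFinP.
apply: le_lt_trans gI; apply: (@le_rint (fun x => `|f x|)%R g) => //.
exact: measurableT_comp.
Qed.

(* Absorption argument: J <= c3 (beta (1 + K) 2 W + K^(1-p) Ct J) + 1 with
   W = 2^(p+1) (1 + m + S J), and the hypotheses make both J-coefficients at most 1/4. *)
Lemma energy_bound (p sigma al K L Ct S m delta : R)
    (a b dd ip th y e F gg tau v : T -> R) :
  1 < p -> 1 < sigma -> 0 < al -> 2 * al <= 1 -> 0 < K -> 0 <= L -> 0 <= Ct ->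
  0 <= S -> 0 <= m ->
  2 `^ (p + 1) * K `^ (1 - p) * Ct <= 1 / 4 ->
  2 `^ (p + 1) * ((2 * al) `^ (p - 1) * (1 + K)) * 2 `^ (p + 2) * (1 + m + S) <= 1 / 4 ->
  (2 `^ (p + 1) + 1) * 3 `^ p * L `^ p * delta <= 1 ->
  [/\ measurable_fun D a, measurable_fun D b, measurable_fun D dd &
      measurable_fun D ip] ->
  [/\ measurable_fun D th, measurable_fun D y & measurable_fun D e] ->
  [/\ measurable_fun D F, measurable_fun D gg, measurable_fun D tau &
      measurable_fun D v] ->
  (forall x, D x -> [/\ 0 <= a x, 0 <= b x & 0 <= dd x]) ->
  (forall x, D x -> [/\ `|ip x| <= a x * b x, b x <= a x + dd x &
      a x ^+ 2 - a x * dd x <= ip x]) ->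
  (forall x, D x -> [/\ 0 <= th x, th x <= L, 0 <= y x, 0 <= e x &
      e x <= th x `^ (p - 1) * y x /\ th x <= 2 * al * (1 + y x)]) ->
  (forall x, D x -> [/\ 0 <= F x, 0 <= gg x, 0 <= tau x & 0 <= v x]) ->
  (rint (fun x => a x `^ (p - 2) * (th x `^ p * ip x))%R <=
   rint (fun x => (F x * e x + gg x `^ (p - 1) * (th x `^ p * tau x)) * v x)%R)%E ->
  (rint (fun x => (th x * tau x) `^ p * v x)%R <=
   Ct%:E * rint (fun x => (th x * b x) `^ p)%R)%E ->
  (forall J : R, rint (fun x => (th x * b x) `^ p)%R <= J%:E ->
     rint (fun x => y x `^ (p * sigma) * v x)%R <= ((S * J) `^ sigma)%:E)%E ->
  (rint (fun x => F x `^ conj_exp sigma * v x)%R <= 1)%E ->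
  (rint (fun x => (gg x `^ p) `^ conj_exp sigma * v x)%R <= 1)%E ->
  (rint (fun x => a x `^ p)%R < +oo)%E ->
  (rint (fun x => dd x `^ p)%R <= delta%:E)%E ->
  (rint v <= m%:E)%E ->
  (rint (fun x => y x `^ (p * sigma) * v x)%R <= ((S * 3) `^ sigma)%:E)%E.
Proof.
move=> p1 s1 al0 al1 K0 L0 Ct0 S0 m0 HK Hal Hdelta.
move=> [ma mb md mip] [mth my me] [mF mg mtau mv] pab pip pth pF.
move=> weak sub sob FI gI aI dI vm.
have p0 : 0 < p by rewrite (lt_trans _ p1).
have p0' := ltW p0.
set c3 := 2 `^ (p + 1) in HK Hal Hdelta.
have c30 : 0 <= c3 by exact: powR_ge0.
pose w x := a x `^ (p - 2) * (th x `^ p * ip x).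
pose thb x := (th x * b x) `^ p.
have mthb : measurable_fun D thb.
  by apply: measurable_powR_comp; exact: measurable_funM.
have mw : measurable_fun D w.
  apply: measurable_funM; first exact: measurable_powR_comp.
  by apply: measurable_funM => //; exact: measurable_powR_comp.
have map := measurable_powR_comp p ma.
have mbp := measurable_powR_comp p mb.
have mdp := measurable_powR_comp p md.
have dfin : (rint (fun x => dd x `^ p)%R < +oo)%E by rewrite (le_lt_trans dI)// ltry.
have bfin : (rint (fun x => b x `^ p)%R < +oo)%E.
  apply: (@le_lt_trans _ _ ((2 `^ p)%:E * rint (fun x => a x `^ p)%R +
      (2 `^ p)%:E * rint (fun x => dd x `^ p)%R)%E).
    apply: le_rint_comb => //; rewrite ?powR_ge0//;
      try by (move=> x _; exact: powR_ge0).
    move=> x Dx; have [a0 b0 d0] := pab x Dx; have [_ bad _] := pip x Dx.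
    by rewrite -mulrDr (le_trans _ (powRD_le p0' a0 d0))// le_powR2.
  apply: lte_add_pinfty; apply: (EFin_mul_lty (powR_ge0 _ _)) => //;
    by apply: rint_ge0 => x _; exact: powR_ge0.
have thbE x : D x -> thb x = th x `^ p * b x `^ p.
  by move=> Dx; have [_ b0 _] := pab x Dx; have [th0 _ _ _ _] := pth x Dx; rewrite /thb powRM.
have thL x : D x -> th x `^ p <= L `^ p.
  by move=> Dx; have [th0 tL _ _ _] := pth x Dx; exact: le_powR2.
(* Absorption is legitimate only for a finite J; this is where the truncation bound th <= L is
   used. *)
have Jfin : (rint thb < +oo)%E.
  apply: (@le_lt_trans _ _ ((L `^ p)%:E * rint (fun x => b x `^ p)%R)%E).
    rewrite -rintZ ?powR_ge0//; last by move=> x _; exact: powR_ge0.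
    apply: le_rint => //.
    - exact: measurable_funM.
    - by move=> x _; exact: powR_ge0.
    - by move=> x Dx; rewrite thbE// ler_wpM2r ?powR_ge0// thL.
  apply: (EFin_mul_lty (powR_ge0 _ _)) => //.
  by apply: rint_ge0 => x _; exact: powR_ge0.
have J0 : (0 <= rint thb)%E by apply: rint_ge0 => x _; exact: powR_ge0.
pose J := fine (rint thb).
have JE : rint thb = J%:E by rewrite fineK// ge0_fin_numE.
have JR0 : 0 <= J by rewrite -lee_fin -JE.
(* As [ip] changes sign, linearity of the integral needs integrability of [w]; Young's inequality
   gives it. *)
have wI : mu.-integrable D (EFin \o w).
  apply: (@integrable_le _ (fun x => L `^ p * (a x `^ p + b x `^ p))) => //.
    by apply: measurable_funM => //; exact: measurable_funD.
  - move=> x Dx; have [a0 b0 d0] := pab x Dx; have [ipab _ _] := pip x Dx.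
    rewrite /w !normrM !(ger0_norm (powR_ge0 _ _)) mulrCA.
    apply: ler_pM; rewrite ?powR_ge0 ?mulr_ge0 ?powR_ge0// ?thL//.
    apply: (@le_trans _ _ (a x `^ (p - 2) * (a x * b x))).
      by rewrite ler_wpM2l ?powR_ge0.
    have p2 : p - 2 + 1 = p - 1 by lra.
    rewrite mulrA powRD1// p2 ?subr_eq0 ?gt_eqF//.
    exact: young_add.
  - rewrite rintZ ?powR_ge0//; last 2 first.
      exact: measurable_funD.
      by move=> x _; rewrite addr_ge0 ?powR_ge0.
    rewrite rintD//; try by (move=> x _; exact: powR_ge0).
    apply: (EFin_mul_lty (powR_ge0 _ _)); last exact: (lte_add_pinfty aI bfin).
    by apply: adde_ge0; apply: rint_ge0 => x _; exact: powR_ge0.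
(* This is [energy_perturbation] multiplied by th^p and integrated; the smallness of delta turns the
   error into at most 1. *)
have lower : (rint thb <= c3%:E * rint w + 1)%E.
  pose c4 := (c3 + 1) * 3 `^ p * L `^ p.
  have c40 : 0 <= c4 by rewrite !mulr_ge0 ?powR_ge0// addr_ge0.
  have dE : mu.-integrable D (EFin \o (fun x => dd x `^ p)).
    apply: (@integrable_le _ (fun x => dd x `^ p)) => // x _.
    by rewrite ger0_norm ?powR_ge0.
  have h1 : (rint thb <= rint (fun x => c3 * w x + c4 * dd x `^ p)%R)%E.
    apply: le_rint => //.
    - by apply: measurable_funD; apply: measurable_funM.
    - by move=> x _; exact: powR_ge0.
    - move=> x Dx; have [a0 b0 d0] := pab x Dx; have [i1 i2 i3] := pip x Dx.
      have := energy_perturbation p1 a0 b0 d0 i1 i2 i3.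
      rewrite -/c3 thbE// => H.
      apply: (le_trans (ler_wpM2l (powR_ge0 (th x) p) H)).
      rewrite mulrDr; apply: lerD; first by rewrite /w le_eqVlt; apply/orP; left; apply/eqP; ring.
      rewrite /c4 -!mulrA mulrCA ler_wpM2l ?addr_ge0//.
      by rewrite mulrCA ler_wpM2l ?powR_ge0// ler_wpM2r ?powR_ge0// thL.
  apply: (le_trans h1).
  have wI' : mu.-integrable D (fun x => c3%:E * (w x)%:E)%E by exact: integrableZl.
  have dE' : mu.-integrable D (fun x => c4%:E * (dd x `^ p)%:E)%E by exact: integrableZl.
  rewrite [leLHS](_ : _ = (\int[mu]_(x in D) (c3%:E * (w x)%:E + c4%:E * (dd x `^ p)%:E))%E)//.
  rewrite (integralD mD wI' dE') (integralZl mD wI) (integralZl mD dE); apply: leeD => //.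
  apply: (@le_trans _ _ (c4%:E * delta%:E)%E); first exact: lee_wpmul2l.
  by rewrite -EFinM lee_fin.
pose be := (2 * al) `^ (p - 1).
have be0 : 0 <= be by exact: powR_ge0.
pose Y x := (1 + y x) `^ p.
have mY : measurable_fun D Y.
  by apply: measurable_powR_comp; apply: measurable_funD.
(* W bounds the L^sigma norm of Y: (1 + y)^(p sigma) <= 2^(p sigma) (1 + y^(p sigma)), and both m
   and (S J)^sigma are at most (1 + m + S J)^sigma, the summand 1 making this base at least 1. The
   remaining factor 2 is absorbed by 2^sigma. *)
pose W := 2 `^ (p + 1) * (1 + m + S * J).
have W0 : 0 < W.
  by rewrite mulr_gt0 ?powR_gt0// ltr_wpDr ?mulr_ge0// ltr_wpDr.
have YI : (rint (fun x => Y x `^ sigma * v x)%R <= (W `^ sigma)%:E)%E.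
  have s0 : 0 < sigma by rewrite (lt_trans _ s1).
  have ps0 : 0 <= p * sigma by rewrite mulr_ge0// ltW.
  apply: (@le_trans _ _ ((2 `^ (p * sigma))%:E * rint v +
      (2 `^ (p * sigma))%:E * rint (fun x => y x `^ (p * sigma) * v x)%R)%E).
    apply: le_rint_comb => //; rewrite ?powR_ge0//.
    - by apply: measurable_funM => //; exact: measurable_powR_comp.
    - by apply: measurable_funM => //; exact: measurable_powR_comp.
    - by move=> x Dx; have [_ _ _ v0] := pF x Dx; rewrite mulr_ge0 ?powR_ge0.
    - by move=> x Dx; have [_ _ _ v0] := pF x Dx.
    - by move=> x Dx; have [_ _ _ v0] := pF x Dx; rewrite mulr_ge0 ?powR_ge0.
    - move=> x Dx; have [_ _ _ v0] := pF x Dx; have [_ _ y0 _ _] := pth x Dx.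
      rewrite mulrA -mulrDl ler_wpM2r// /Y -powRrM.
      have := powRD_le ps0 ler01 y0; rewrite powR1 mulrDr mulr1; exact.
  apply: (@le_trans _ _ ((2 `^ (p * sigma))%:E * m%:E +
      (2 `^ (p * sigma))%:E * ((S * J) `^ sigma)%:E)%E).
    apply: leeD; apply: lee_wpmul2l; rewrite ?lee_fin ?powR_ge0//.
    by apply: sob; rewrite -/thb JE.
  rewrite -!EFinM -EFinD lee_fin -mulrDr /W.
  have SJ0 : 0 <= S * J by rewrite mulr_ge0.
  have Z0 : 0 <= 1 + m + S * J by rewrite !addr_ge0.
  have -> : 2 `^ (p + 1) = 2 `^ p * 2 :> R.
    by rewrite powRD ?pnatr_eq0 ?implybT// powRr1.
  rewrite -mulrA [leRHS]powRM ?powR_ge0 ?mulr_ge0// -powRrM ler_wpM2l ?powR_ge0//.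
  apply: (@le_trans _ _ (2 * (1 + m + S * J) `^ sigma)).
    rewrite mulr2n mulrDl !mul1r lerD//; last by apply: le_powR2; rewrite ?(ltW s0)// lerDr addr_ge0.
    apply: (@le_trans _ _ (1 + m + S * J)); first lra.
    by apply: le1r_powR; rewrite ?(ltW s1)//; lra.
  rewrite [leRHS]powRM// ler_wpM2r ?powR_ge0//.
  by apply: le1r_powR; rewrite ?(ltW s1)//; lra.
have Y0 x : D x -> 0 <= Y x by move=> _; exact: powR_ge0.
have hoelder f : measurable_fun D f -> (forall x, D x -> 0 <= f x) ->
    (rint (fun x => f x `^ conj_exp sigma * v x)%R <= 1)%E ->
    (rint (fun x => f x * Y x * v x)%R <= (2 * W)%:E)%E.
  move=> mf f0 fI; apply: (@rint_hoelder sigma W f Y v s1 W0) => //.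
  by move=> x Dx; have [_ _ _ v0] := pF x Dx.
have thY x : D x -> th x `^ (p - 1) <= be * (1 + y x) `^ (p - 1).
  move=> Dx; have [th0 _ y0 _ [_ t1]] := pth x Dx.
  rewrite -powRM ?addr_ge0//; last by rewrite mulr_ge0// ltW.
  by apply: le_powR2 => //; rewrite subr_ge0 ltW.
have eY x : D x -> e x <= be * Y x.
  move=> Dx; have [th0 _ y0 _ [e1 _]] := pth x Dx; apply: (le_trans e1).
  rewrite /Y -(powRB1 p0) ?addr_ge0// mulrA.
  by rewrite ler_pM ?powR_ge0// ?thY// lerDr.
have thpY x : D x -> th x `^ p <= be * Y x.
  move=> Dx; have [th0 _ y0 _ [_ t1]] := pth x Dx.
  have y1 : 0 <= 1 + y x by rewrite addr_ge0.
  rewrite /Y -(powRB1 p0 y1) -(powRB1 p0 th0) mulrA.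
  rewrite ler_pM ?powR_ge0// ?thY//; apply: (le_trans t1).
  by rewrite ler_piMl ?addr_ge0.
have upper : (rint (fun x => (F x * e x + gg x `^ (p - 1) * (th x `^ p * tau x)) * v x)%R <=
    (be * (2 * W) + (K * be * (2 * W) + K `^ (1 - p) * (Ct * J)))%:E)%E.
  have me1 : measurable_fun D (fun x => F x * Y x * v x).
    by apply: measurable_funM => //; exact: measurable_funM.
  have mgp := measurable_powR_comp p mg.
  have me2 : measurable_fun D (fun x => gg x `^ p * Y x * v x).
    by apply: measurable_funM => //; exact: measurable_funM.
  have me3 : measurable_fun D (fun x => (th x * tau x) `^ p * v x).
    apply: measurable_funM => //; apply: measurable_powR_comp; exact: measurable_funM.
  have me4 : measurable_fun D (fun x => K * be * (gg x `^ p * Y x * v x) +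
      K `^ (1 - p) * ((th x * tau x) `^ p * v x)).
    by apply: measurable_funD; apply: measurable_funM.
  have p4 x : D x -> 0 <= gg x `^ p * Y x * v x.
    by move=> Dx; have [_ _ _ v0] := pF x Dx; rewrite !mulr_ge0 ?powR_ge0.
  have p5 x : D x -> 0 <= (th x * tau x) `^ p * v x.
    by move=> Dx; have [_ _ _ v0] := pF x Dx; rewrite !mulr_ge0 ?powR_ge0.
  apply: (@le_trans _ _ (be%:E * rint (fun x => F x * Y x * v x)%R +
      1%:E * rint (fun x => K * be * (gg x `^ p * Y x * v x) +
      K `^ (1 - p) * ((th x * tau x) `^ p * v x))%R)%E).
    apply: le_rint_comb => //.
    - apply: measurable_funM => //; apply: measurable_funD; first exact: measurable_funM.
      apply: measurable_funM; first exact: measurable_powR_comp.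
      by apply: measurable_funM => //; exact: measurable_powR_comp.
    - move=> x Dx; have [F0 g0 t0 v0] := pF x Dx; have [_ _ _ e0 _] := pth x Dx.
      by rewrite mulr_ge0// addr_ge0// !mulr_ge0 ?powR_ge0.
    - by move=> x Dx; have [F0 g0 t0 v0] := pF x Dx; rewrite !mulr_ge0 ?powR_ge0.
    - move=> x Dx; rewrite addr_ge0// mulr_ge0 ?powR_ge0 ?p4 ?p5//.
      by rewrite mulr_ge0// ltW.
    - move=> x Dx; have [F0 g0 t0 v0] := pF x Dx; have [th0 _ y0 e0 _] := pth x Dx.
      have h1 : F x * e x <= be * (F x * Y x).
        by rewrite (mulrCA be) ler_wpM2l// eY.
      have h2 : gg x `^ (p - 1) * (th x `^ p * tau x) <=
          K * be * (gg x `^ p * Y x) + K `^ (1 - p) * (th x * tau x) `^ p.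
        (* The factor th^p is shared as th^(p-1) th, so that Young's inequality applies to gg th and
           th tau. *)
        have := weighted_young p1 K0 (mulr_ge0 g0 th0) (mulr_ge0 th0 t0).
        rewrite [in leLHS]powRM// -(mulrA (gg x `^ _)) (mulrA (th x `^ _)) powRB1//.
        move=> H; apply: (le_trans H); rewrite lerD2r powRM// -!mulrA ler_wpM2l ?(ltW K0)//.
        by rewrite mulrCA ler_wpM2l ?powR_ge0// thpY.
      apply: (le_trans (ler_wpM2r v0 (lerD h1 h2))).
      by rewrite le_eqVlt; apply/orP; left; apply/eqP; ring.
  rewrite rintD; last 4 first.
  - exact: measurable_funM.
  - exact: measurable_funM.
  - by move=> x Dx; rewrite mulr_ge0 ?p4// mulr_ge0// ltW.
  - by move=> x Dx; rewrite mulr_ge0 ?p5 ?powR_ge0.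
  rewrite rintZ// ?(mulr_ge0 (ltW K0) be0)// rintZ ?powR_ge0// mul1e.
  rewrite 2!EFinD; apply: leeD; [|apply: leeD].
  - rewrite [leRHS]EFinM lee_wpmul2l//; apply: hoelder => // x Dx.
    by have [] := pF x Dx.
  - rewrite [leRHS]EFinM lee_wpmul2l ?lee_fin ?(mulr_ge0 (ltW K0) be0)//.
    by apply: hoelder => // x _; exact: powR_ge0.
  - rewrite [leRHS]EFinM lee_wpmul2l ?lee_fin ?powR_ge0//.
    by apply: (le_trans sub); rewrite -/thb JE EFinM.
have {}lower : J <= c3 * (be * (2 * W) + (K * be * (2 * W) + K `^ (1 - p) * (Ct * J))) + 1.
  rewrite -lee_fin -JE; apply: (le_trans lower); rewrite EFinD EFinM.
  by apply: leeD => //; apply: lee_wpmul2l; rewrite ?lee_fin//; exact: le_trans weak upper.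
(* Using 1 + m + S J <= (1 + m + S)(1 + J), the smallness conditions give J <= (1 + J)/4 + J/4 + 1,
   hence J <= 5/2. *)
have J3 : J <= 3.
  have -> : 3 = 5 / 2 + 1 / 2 :> R by lra.
  have e1 : c3 * (K `^ (1 - p) * (Ct * J)) <= J / 4.
    rewrite !mulrA; have := ler_wpM2r JR0 HK; lra.
  have e2 : c3 * (be * (2 * W) + K * be * (2 * W)) <= (1 + J) / 4.
    have W1 : W <= 2 `^ (p + 1) * ((1 + m + S) * (1 + J)).
      rewrite ler_wpM2l ?powR_ge0//; nra.
    have q0 : 0 <= c3 * (be * (1 + K)) * 2.
      by rewrite !mulr_ge0// addr_ge0// ltW.
    have h := ler_wpM2l q0 W1.
    have p2E : 2 `^ (p + 2) = 2 * 2 `^ (p + 1) :> R.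
      have -> : p + 2 = p + 1 + 1 by lra.
      by rewrite powRD ?pnatr_eq0 ?implybT// powRr1// mulrC.
    have J1 : 0 <= 1 + J by rewrite addr_ge0.
    have := ler_wpM2r J1 Hal; rewrite p2E -/be => h2.
    have -> : c3 * (be * (2 * W) + K * be * (2 * W)) = c3 * (be * (1 + K)) * 2 * W by ring.
    apply: (le_trans h).
    rewrite [leLHS](_ : _ = c3 * (be * (1 + K)) * (2 * 2 `^ (p + 1)) * (1 + m + S) * (1 + J)).
      by apply: (le_trans h2); lra.
    by ring.
  lra.
by apply: sob; rewrite -/thb JE lee_fin.
Qed.

End real_integrals.

(** * The seminorm of Q *)

Section quadratic_seminorm.
Context {R : realType} {n : nat}.
Implicit Types (xi eta : 'rV[R]_n.+1) (Q : 'M[R]_n.+1).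

Definition qnorm Q xi : R := enorm (appmx (sqrtmx Q) xi).

Lemma sqrtmxP Q : nonneg_sym Q -> nonneg_sym (sqrtmx Q) /\ sqrtmx Q *m sqrtmx Q = Q.
Proof.
move=> Q0; exact: (@xgetPex _ 0 [set S | nonneg_sym S /\ S *m S = Q] (sqrtmx_exists Q0)).
Qed.

Lemma appmxM (A B : 'M[R]_n.+1) xi : appmx (A *m B) xi = appmx A (appmx B xi).
Proof. by rewrite /appmx trmxK mulmxA. Qed.

Lemma appmxD Q xi eta : appmx Q (xi + eta) = appmx Q xi + appmx Q eta.
Proof. by rewrite /appmx !linearD. Qed.

Lemma appmxZ Q c xi : appmx Q (c *: xi) = c *: appmx Q xi.
Proof. by rewrite /appmx !linearZ. Qed.

Lemma qnorm_ge0 Q xi : 0 <= qnorm Q xi.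
Proof. exact: sqrtr_ge0. Qed.

Lemma dotp_sqrtmx Q xi eta : nonneg_sym Q ->
  dotp xi (appmx Q eta) = dotp (appmx (sqrtmx Q) xi) (appmx (sqrtmx Q) eta).
Proof.
by move=> /sqrtmxP[[ST _] SS]; rewrite -[in LHS]SS appmxM dotp_appmx ST.
Qed.

Lemma qnorm_sqr Q xi : nonneg_sym Q -> qnorm Q xi ^+ 2 = dotp xi (appmx Q xi).
Proof. by move=> Q0; rewrite /qnorm /enorm sqr_sqrtr ?dotp_ge0// [RHS]dotp_sqrtmx. Qed.

Lemma qnormE Q xi : nonneg_sym Q -> qnorm Q xi = Num.sqrt (dotp xi (appmx Q xi)).
Proof. by move=> Q0; rewrite -qnorm_sqr// sqrtr_sqr ger0_norm ?qnorm_ge0. Qed.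

Lemma enormZ c xi : enorm (c *: xi) = `|c| * enorm xi.
Proof. by rewrite /enorm dotpZl dotpZr mulrA -expr2 sqrtrM ?sqr_ge0// sqrtr_sqr. Qed.

Lemma qnormZ Q c xi : qnorm Q (c *: xi) = `|c| * qnorm Q xi.
Proof. by rewrite /qnorm appmxZ enormZ. Qed.

Lemma dotp_cauchy_schwarz xi eta : `|dotp xi eta| <= enorm xi * enorm eta.
Proof.
rewrite -[leLHS]sqrtr_sqr -sqrtrM ?dotp_ge0// ler_sqrt ?mulr_ge0 ?dotp_ge0//.
have [e0|e0] := eqVneq (dotp eta eta) 0.
  have /eqP -> : eta == 0 by rewrite -dotp_eq0 e0.
  by rewrite -(scale0r (0 : 'rV[R]_n.+1)) !dotpZr !mul0r mulr0 expr0n.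
have ep : 0 < dotp eta eta by rewrite lt_neqAle eq_sym e0 dotp_ge0.
have := dotp_ge0 (dotp eta eta *: xi + (- dotp xi eta) *: eta).
rewrite dotpDl !dotpDr !dotpZl !dotpZr (dotpC eta xi) => H.
rewrite -subr_ge0 -(pmulr_rge0 _ ep); apply: le_trans H _.
by rewrite le_eqVlt; apply/orP; left; apply/eqP; ring.
Qed.

Lemma qnorm_cauchy_schwarz Q xi eta : nonneg_sym Q ->
  `|dotp xi (appmx Q eta)| <= qnorm Q xi * qnorm Q eta.
Proof. by move=> Q0; rewrite dotp_sqrtmx//; exact: dotp_cauchy_schwarz. Qed.

Lemma qnorm_triangle Q xi eta : nonneg_sym Q ->
  qnorm Q xi <= qnorm Q eta + qnorm Q (xi - eta).
Proof.
move=> Q0; rewrite -[leLHS]ger0_norm ?qnorm_ge0// -[leRHS]ger0_norm ?addr_ge0 ?qnorm_ge0//.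
rewrite -ler_sqr ?nnegrE// !real_normK ?num_real//.
move: (subrK eta xi) ; move: (xi - eta) => z <- {xi}.
have -> : qnorm Q (z + eta) ^+ 2 = qnorm Q eta ^+ 2 + qnorm Q z ^+ 2
    + 2 * dotp z (appmx Q eta).
  have H : dotp eta (appmx Q z) = dotp z (appmx Q eta).
    by rewrite dotp_appmx Q0.1 dotpC.
  rewrite !qnorm_sqr// appmxD !dotpDl !dotpDr H; ring.
have := ler_norm (dotp z (appmx Q eta)).
have := qnorm_cauchy_schwarz z eta Q0; nra.
Qed.

(** Writing xi = eta + (xi - eta), the first part contributes the square and Cauchy-Schwarz controls
    the second. It supplies the lower bound on [ip] in [energy_perturbation]. *)
Lemma dotp_qnorm_lower Q xi eta : nonneg_sym Q ->
  qnorm Q eta ^+ 2 - qnorm Q eta * qnorm Q (xi - eta) <= dotp xi (appmx Q eta).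
Proof.
move=> Q0; rewrite -[in leRHS](subrK eta xi) dotpDl -qnorm_sqr//.
have := lerNnormlW (lexx `|dotp (xi - eta) (appmx Q eta)|).
have := qnorm_cauchy_schwarz (xi - eta) eta Q0; lra.
Qed.

End quadratic_seminorm.

(** * Measurability of vector fields and of the seminorm *)

Section measurable_vector_fields.
Context {R : realType} {n : nat}.
Local Notation Rn := ('rV[R]_n.+1).
Variable Omega : set Rn.
Hypothesis mO : measurable Omega.
Implicit Types (G t : Rn -> Rn) (Q : Rn -> 'M[R]_n.+1).

Lemma measurable_dotp t G : measurable_vfun Omega t -> measurable_vfun Omega G ->
  measurable_fun Omega (fun x => dotp (t x) (G x)).
Proof. by move=> mt mG; apply: measurable_sum => i; exact: measurable_funM. Qed.

Lemma measurable_appmx Q G : measurable_mxfun Omega Q -> measurable_vfun Omega G ->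
  measurable_vfun Omega (fun x => appmx (Q x) (G x)).
Proof.
move=> mQ mG i; have -> : (fun x => appmx (Q x) (G x) ord0 i) =
    (fun x => \sum_j Q x i j * G x ord0 j).
  by apply/funext => x; rewrite !mxE; apply: eq_bigr => j _; rewrite !mxE.
by apply: measurable_sum => j; exact: measurable_funM.
Qed.

(** [sqrtmx] is a pointwise choice, so its dependence on x is opaque; the formula sqrt(G . Q G)
    avoids it. *)
Lemma measurable_qnorm Q G : measurable_mxfun Omega Q -> measurable_vfun Omega G ->
  (forall x, Omega x -> nonneg_sym (Q x)) ->
  measurable_fun Omega (fun x => qnorm (Q x) (G x)).
Proof.
move=> mQ mG Q0.
apply: (@eq_measurable_fun _ _ _ _ Omega
    (fun x => Num.sqrt (dotp (G x) (appmx (Q x) (G x))))).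
  by move=> x; rewrite inE => Ox; rewrite qnormE//; exact: Q0.
apply: (measurableT_comp (continuous_measurable_fun (@sqrt_continuous R))).
exact: (measurable_dotp mG (measurable_appmx mQ mG)).
Qed.

Lemma measurable_vfunB t G : measurable_vfun Omega t -> measurable_vfun Omega G ->
  measurable_vfun Omega (fun x => t x - G x).
Proof.
move=> mt mG i; have -> : (fun x => (t x - G x) ord0 i) =
    (fun x => t x ord0 i - G x ord0 i) by apply/funext => x; rewrite !mxE.
exact: measurable_funB.
Qed.

Lemma measurable_grad psi : lip0 Omega psi -> measurable_vfun Omega (grad psi).
Proof.
move=> /lip0_continuous cpsi i.
have -> : (fun x => grad psi x ord0 i) = (fun x => 'D_(delta_mx ord0 i) psi x).
  by apply/funext => x; rewrite mxE.
exact: measurable_partial.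
Qed.

End measurable_vector_fields.

(** * Norms and integrals *)

Lemma le_poweR_inv {R : realType} (p c : R) (X : \bar R) : 0 < p -> (0 <= X)%E -> 0 <= c ->
  (poweR X p^-1 <= c%:E)%E = (X <= (c `^ p)%:E)%E.
Proof.
move=> p0 + c0; have p1 : 0 <= p^-1 by rewrite invr_ge0 ltW.
case: X => [x x0| |//].
  rewrite lee_fin in x0; rewrite poweR_EFin !lee_fin; apply/idP/idP => [H|H].
    by have := le_powR2 (ltW p0) (powR_ge0 _ _) H; rewrite -powRrM mulVf ?gt_eqF// powRr1.
  by have := le_powR2 p1 x0 H; rewrite -powRrM mulfV ?gt_eqF// powRr1.
by move=> _; rewrite poweRyr ?invr_eq0 ?gt_eqF// !leye_eq.
Qed.

Section norms.
Context {R : realType} {n : nat}.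
Local Notation Rn := ('rV[R]_n.+1).
Variables (Omega : set Rn) (p : R) (v : Rn -> R).
Hypotheses (oO : open Omega) (p1 : 1 < p) (vw : weight Omega v).
Implicit Types (Q : Rn -> 'M[R]_n.+1) (t : Rn -> Rn) (h phi : Rn -> R).
Local Notation rint := (rint leb Omega).

Let p0 : 0 < p. Proof. exact: lt_trans p1. Qed.
Let mO : measurable Omega. Proof. exact: open_measurable_rV. Qed.

(** A strict bound yields an admissible value below l without asking whether the infimum is
    attained. *)
Lemma Orlicz_norm_lt (Phi : R -> R) h (l : R) :
  (Orlicz_norm Phi v Omega h < l%:E)%E ->
  exists2 l', 0 < l' < l & (rint (fun x => Phi (`|h x| / l') * v x)%R <= 1)%E.
Proof.
move=> /ereal_inf_lt[_ [l' [l'0 H] <-]]; rewrite lte_fin => l'l.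
by exists l' => //; rewrite l'0.
Qed.

Lemma Orlicz_norm_le (Phi : R -> R) h (l : R) : 0 < l ->
  (rint (fun x => Phi (`|h x| / l) * v x)%R <= 1)%E -> (Orlicz_norm Phi v Omega h <= l%:E)%E.
Proof. by move=> l0 H; apply: ereal_inf_lbound; exists l. Qed.

Lemma subunit_rint Q t (Ct : R) phi : 0 < Ct -> subunit v Q Omega p t Ct ->
  lip0 Omega phi ->
  (rint (fun x => `|dotp (t x) (grad phi x)| `^ p * v x)%R <=
   (Ct `^ p)%:E * rint (fun x => qnorm (Q x) (grad phi x) `^ p)%R)%E.
Proof.
move=> Ct0 tQ phiL; have := tQ phi phiL.
rewrite /Lp_norm /QLp_norm.
set X := (\int[leb]_(x in Omega) (`|dotp (t x) (grad phi x)| `^ p * v x)%:E)%E.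
set Y := (\int[leb]_(x in Omega) _)%E => H; change (X <= (Ct `^ p)%:E * Y)%E.
have X0 : (0 <= X)%E.
  by apply: integral_ge0 => x Ox; rewrite lee_fin mulr_ge0 ?powR_ge0// vw.2.
have Y0 : (0 <= Y)%E by apply: integral_ge0 => x Ox; rewrite lee_fin powR_ge0.
move: Y0 H; case: Y => [y| |]//; last by rewrite gt0_muley ?leey// lte_fin powR_gt0.
rewrite lee_fin => y0; rewrite poweR_EFin -EFinM le_poweR_inv//; last first.
  by rewrite mulr_ge0 ?powR_ge0 ?(ltW Ct0).
by rewrite powRM ?powR_ge0 ?(ltW Ct0)// -powRrM mulVf ?gt_eqF// powRr1// EFinM.
Qed.

Lemma sobolev_rint Q (sigma SN J : R) phi : 0 < sigma ->
  Sobolev v Q Omega p (young_N sigma p) SN -> lip0 Omega phi ->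
  (rint (fun x => qnorm (Q x) (grad phi x) `^ p)%R <= J%:E)%E ->
  (rint (fun x => `|phi x| `^ (p * sigma) * v x)%R <=
   (((`|SN| + 1) `^ p * J) `^ sigma)%:E)%E.
Proof.
(* No sign is assumed on [SN]; replacing it by |SN| + 1 gives a positive constant that is at least
   as large. *)
move=> s0 sob phiL YJ; set S := `|SN| + 1.
have S0 : 0 <= S by rewrite addr_ge0.
have q0 : 0 < p * sigma by rewrite mulr_gt0.
have Y0 : (0 <= rint (fun x => qnorm (Q x) (grad phi x) `^ p)%R)%E.
  by apply: rint_ge0 => x _; exact: powR_ge0.
have J0 : 0 <= J by rewrite -lee_fin (le_trans Y0).
pose c := S * J `^ p^-1.
have c0 : 0 <= c by rewrite mulr_ge0 ?powR_ge0.
have Qle : (QLp_norm Q Omega p (grad phi) <= (J `^ p^-1)%:E)%E.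
  change (poweR (rint (fun x => qnorm (Q x) (grad phi x) `^ p)%R) p^-1 <= (J `^ p^-1)%:E)%E.
  by rewrite le_poweR_inv ?powR_ge0// -powRrM mulVf ?gt_eqF// powRr1.
have Oc : (Orlicz_norm (young_N sigma p) v Omega phi <= c%:E)%E.
  apply: (le_trans (sob phi phiL)); apply: (@le_trans _ _ (S%:E * QLp_norm Q Omega p (grad phi))%E).
    apply: lee_wpmul2r; first exact: poweR_ge0.
    by rewrite lee_fin (le_trans (ler_norm _))// lerDl.
  by rewrite /c EFinM lee_wpmul2l.
set X := rint (fun x => `|phi x| `^ (p * sigma) * v x)%R.
have X0 : (0 <= X)%E.
  by apply: rint_ge0 => x Ox; rewrite mulr_ge0 ?powR_ge0// vw.2.
have mphi : measurable_fun Omega phi.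
  by apply: continuous_measurable_rV => //; exact: lip0_continuous phiL.
(* The room e produces an admissible value l < c + e of the Luxemburg norm; e then tends to 0. *)
have Xe e : 0 < e -> (poweR X (p * sigma)^-1 <= (c + e)%:E)%E.
  move=> e0; have /Orlicz_norm_lt[l /andP[l0 lc] H] :
      (Orlicz_norm (young_N sigma p) v Omega phi < (c + e)%:E)%E.
    by rewrite (le_lt_trans Oc)// lte_fin ltrDl.
  rewrite le_poweR_inv//; last by rewrite addr_ge0// ltW.
  apply: (@le_trans _ _ (l `^ (p * sigma))%:E); last first.
    by rewrite lee_fin; apply: le_powR2; rewrite ?ltW.
  have mabs : measurable_fun Omega (fun x => `|phi x|).
    exact: (measurableT_comp (@normr_measurable R setT) mphi).
  have ml : measurable_fun Omega (fun x => `|phi x| / l).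
    exact: (measurable_funM mabs (measurable_cst _)).
  have mN : measurable_fun Omega (fun x => young_N sigma p (`|phi x| / l) * v x).
    exact: (measurable_funM (measurable_powR_comp (sigma * p) ml) vw.1).
  have mX : measurable_fun Omega (fun x => `|phi x| `^ (p * sigma) * v x).
    exact: (measurable_funM (measurable_powR_comp (p * sigma) mabs) vw.1).
  have mN' : measurable_fun Omega
      (fun x => l `^ (p * sigma) * (young_N sigma p (`|phi x| / l) * v x)).
    exact: (measurable_funM (measurable_cst _) mN).
  have N0 x : Omega x -> 0 <= young_N sigma p (`|phi x| / l) * v x.
    by move=> Ox; rewrite mulr_ge0 ?powR_ge0// vw.2.
  have phi0 x : Omega x -> 0 <= `|phi x| `^ (p * sigma) * v x.
    by move=> Ox; rewrite mulr_ge0 ?powR_ge0// vw.2.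
  have phiN x : Omega x -> `|phi x| `^ (p * sigma) * v x <=
      l `^ (p * sigma) * (young_N sigma p (`|phi x| / l) * v x).
    move=> Ox; rewrite /young_N mulrA ler_wpM2r ?vw.2// (mulrC sigma).
    by rewrite -powRM ?divr_ge0 ?(ltW l0)// mulrCA mulfV ?gt_eqF// mulr1.
  apply: (le_trans (le_rint leb mO mX mN' phi0 phiN)).
  rewrite (rintZ leb mO (powR_ge0 _ _) mN N0) -[leRHS]mule1.
  by apply: lee_wpmul2l => //; rewrite lee_fin powR_ge0.
have : (poweR X (p * sigma)^-1 <= c%:E)%E.
  by apply/lee_addgt0Pr => e e0; rewrite -EFinD; exact: Xe.
rewrite le_poweR_inv// => /le_trans; apply.
have -> : (c `^ (p * sigma) = (S `^ p * J) `^ sigma).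
  by rewrite /c powRrM [in LHS]powRM ?powR_ge0// -(powRrM J) mulVf ?gt_eqF// powRr1.
by [].
Qed.

(** The logarithm of e + t is at least 1. *)
Lemma le_young (q t : R) : 0 <= q -> 0 <= t -> t `^ q <= t `^ q * ln (expR 1 + t) `^ q.
Proof.
move=> q0 t0; rewrite ler_peMr ?powR_ge0//.
have H : 1 <= ln (expR 1 + t).
  rewrite -[leLHS](@expRK R); rewrite ler_ln ?posrE ?expR_gt0 ?lerDl//.
  by rewrite ltr_wpDr ?expR_gt0.
by have := le_powR2 q0 ler01 H; rewrite powR1.
Qed.

(** [young_A] and [young_B] both have this shape, with q equal to sigma' (p - 1) and p sigma'. *)
Lemma Orlicz_young_rint (q l : R) h : 0 < q -> measurable_fun Omega h ->
  (Orlicz_norm (fun s : R => s `^ q * ln (expR 1 + s) `^ q)%R v Omega h < l%:E)%E ->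
  (rint (fun x => `|h x / l| `^ q * v x)%R <= 1)%E.
Proof.
move=> q0 mh /Orlicz_norm_lt[l' /andP[l'0 l'l]]; apply: le_trans.
have l0 : 0 < l by exact: lt_trans l'l.
have mabs : measurable_fun Omega (fun x => `|h x|).
  exact: (measurableT_comp (@normr_measurable R setT) mh).
have mhl : measurable_fun Omega (fun x => `|h x / l|).
  apply: (measurableT_comp (@normr_measurable R setT)).
  exact: (measurable_funM mh (measurable_cst _)).
have ml : measurable_fun Omega (fun x => `|h x| / l').
  exact: (measurable_funM mabs (measurable_cst _)).
have mln : measurable_fun Omega (fun x => ln (expR 1 + `|h x| / l')).
  apply: (measurableT_comp (@measurable_ln R)).
  exact: (measurable_funD (measurable_cst _) ml).
have mY : measurable_fun Omega
    (fun x => (`|h x| / l') `^ q * ln (expR 1 + `|h x| / l') `^ q * v x).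
  have mYq := measurable_funM (measurable_powR_comp q ml) (measurable_powR_comp q mln).
  exact: (measurable_funM mYq vw.1).
have mX : measurable_fun Omega (fun x => `|h x / l| `^ q * v x).
  exact: (measurable_funM (measurable_powR_comp q mhl) vw.1).
have h0 x : Omega x -> 0 <= `|h x / l| `^ q * v x.
  by move=> Ox; rewrite mulr_ge0 ?powR_ge0// vw.2.
apply: (le_rint leb mO mX mY h0) => x Ox; rewrite ler_wpM2r ?vw.2//.
apply: (le_trans _ (le_young (ltW q0) (divr_ge0 (normr_ge0 _) (ltW l'0)))).
apply: le_powR2; rewrite ?(ltW q0)// normrM normfV (gtr0_norm l0).
by rewrite ler_wpM2l// lef_pV2 ?posrE// ltW.
Qed.

End norms.

(** * The energy estimate for test functions *)

(** As p - 1 > 0, any positive value of K^(p-1) and of (2 al)^(p-1) can be prescribed. K is chosen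
    first, to absorb the subunit term; al comes next, because its condition contains K. *)
Lemma energy_constants {R : realType} (p Ct S m : R) : 1 < p -> 0 < Ct -> 0 <= S -> 0 <= m ->
  exists K al : R, [/\ 0 < K, 0 < al, 2 * al <= 1,
    2 `^ (p + 1) * K `^ (1 - p) * Ct <= 1 / 4 &
    2 `^ (p + 1) * ((2 * al) `^ (p - 1) * (1 + K)) * 2 `^ (p + 2) * (1 + m + S) <= 1 / 4].
Proof.
move=> p1 Ct0 S0 m0; set c := 2 `^ (p + 1).
have c0 : 0 < c by rewrite powR_gt0.
have pm0 : p - 1 != 0 by rewrite subr_eq0 gt_eqF.
have root (z : R) : 0 < z -> exists2 y, 0 < y & y `^ (p - 1) = z.
  move=> z0; exists (z `^ (p - 1)^-1); first by rewrite powR_gt0.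
  by rewrite -powRrM mulVf// powRr1// ltW.
have cC0 : 0 < 4 * c * Ct by rewrite !mulr_gt0.
have [K K0 KE] := root _ cC0.
pose A := 4 * (c * (1 + K) * 2 `^ (p + 2) * (1 + m + S)).
have A0 : 0 < A.
  have h1 : 0 < 1 + K by rewrite addr_gt0.
  have h2 : 0 < 1 + m + S by rewrite -addrA ltr_wpDr ?addr_ge0.
  have h3 : 0 < 2 `^ (p + 2) :> R by rewrite powR_gt0.
  by rewrite /A !mulr_gt0.
have AV0 : 0 < A^-1 by rewrite invr_gt0.
have [be be0 beE] := root _ AV0.
exists K, (Num.min be 1 / 2); split => //.
- by rewrite divr_gt0// lt_min be0 ltr01.
- by rewrite mulrC divfK// ge_min lexx orbT.
- have -> : K `^ (1 - p) = (4 * c * Ct)^-1 by rewrite -KE -powRN opprB.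
  by rewrite le_eqVlt; apply/orP; left; apply/eqP; field; rewrite !gt_eqF.
- rewrite (mulrC 2) divfK//.
  have H : Num.min be 1 `^ (p - 1) <= A^-1.
    rewrite -beE; apply: le_powR2; first by rewrite subr_ge0 ltW.
      by rewrite le_min (ltW be0) ler01.
    by rewrite ge_min lexx.
  rewrite [leLHS](_ : _ = Num.min be 1 `^ (p - 1) * A / 4); last by rewrite /A; field.
  by rewrite ler_pM2r// -ler_pdivlMr// div1r.
Qed.

(** Since B <= M, z may be replaced by min(z, M), whose power q is at most M^(q-p) z^p. Thus
    convergence in L^p(v) is enough to control the larger power q = p sigma of a bounded
    quantity. *)
Lemma truncated_power {R : realType} (p q B y z M : R) : 0 < p -> p <= q ->
  0 <= y -> 0 <= z -> 0 <= B <= M -> B <= y + z ->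
  B `^ q <= 2 `^ q * (y `^ q + M `^ (q - p) * z `^ p).
Proof.
move=> p0 pq y0 z0 /andP[B0 BM] Byz.
have q0 : 0 <= q by rewrite (le_trans _ pq)// ltW.
have M0 : 0 <= M by exact: le_trans BM.
pose w := Num.min z M.
have w0 : 0 <= w by rewrite le_min z0.
have Byw : B <= y + w.
  rewrite /w minEle; case: ifP => _ //.
  by rewrite (le_trans BM)// lerDr.
apply: (le_trans (le_powR2 q0 B0 Byw)); apply: (le_trans (powRD_le q0 y0 w0)).
rewrite ler_wpM2l ?powR_ge0// lerD2l.
have [->|wn0] := eqVneq w 0.
  by rewrite powR0 ?mulr_ge0 ?powR_ge0// gt_eqF// (lt_le_trans p0).
have -> : w `^ q = w `^ (q - p) * w `^ p by rewrite -powRD ?wn0 ?implybT// subrK.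
have qp0 : 0 <= q - p by rewrite subr_ge0.
apply: ler_pM; rewrite ?powR_ge0//; apply: le_powR2; rewrite ?(ltW p0)// /w ge_min lexx//.
by rewrite orbT.
Qed.

Section test_step.
Context {R : realType} {n : nat}.
Local Notation Rn := ('rV[R]_n.+1).
Variables (Omega : set Rn) (p sigma : R) (v : Rn -> R) (t : Rn -> Rn) (Ct SN m : R).
Hypotheses (oO : open Omega) (p1 : 1 < p) (s1 : 1 < sigma) (vw : weight Omega v).
Hypotheses (mt : measurable_vfun Omega t) (Ct0 : 0 < Ct).
Local Notation rint := (rint leb Omega).
Local Notation S := ((`|SN| + 1) `^ p).
Hypothesis vm : (rint v <= m%:E)%E.
Variables (K al : R).
Hypotheses (K0 : 0 < K) (al0 : 0 < al) (al1 : 2 * al <= 1).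
Hypothesis HK : 2 `^ (p + 1) * K `^ (1 - p) * Ct `^ p <= 1 / 4.
Hypothesis Hal :
  2 `^ (p + 1) * ((2 * al) `^ (p - 1) * (1 + K)) * 2 `^ (p + 2) * (1 + m + S) <= 1 / 4.
Variable Q : Rn -> 'M[R]_n.+1.
Hypotheses (mQ : measurable_mxfun Omega Q) (Q0 : forall x, Omega x -> nonneg_sym (Q x)).
Hypotheses (Qt : subunit v Q Omega p t Ct) (QS : Sobolev v Q Omega p (young_N sigma p) SN).
Variables (f g : Rn -> R) (G : Rn -> Rn).
Hypotheses (mf : measurable_fun Omega f) (mg : measurable_fun Omega g).
Hypothesis fI : (rint (fun x => (`|f x| `^ (p - 1)) `^ conj_exp sigma * v x)%R <= 1)%E.
Hypothesis gI : (rint (fun x => (`|g x| `^ p) `^ conj_exp sigma * v x)%R <= 1)%E.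
Hypotheses (mG : measurable_vfun Omega G).
Hypothesis GI : (rint (fun x => qnorm (Q x) (G x) `^ p)%R < +oo)%E.

(* What both a subsolution and the opposite of a supersolution satisfy. *)
Definition weak_ineq : Prop := forall phi, lip0 Omega phi ->
  (forall x, Omega x -> 0 <= phi x) ->
  (rint (fun x => qnorm (Q x) (grad phi x) `^ p)%R < +oo)%E ->
  (rint (fun x => qnorm (Q x) (G x) `^ (p - 2) * dotp (grad phi x) (appmx (Q x) (G x)))%R <=
   rint (fun x => (`|f x| `^ (p - 1) * phi x +
                   `|g x| `^ (p - 1) * `|dotp (t x) (grad phi x)|) * v x)%R)%E.
Hypothesis weak : weak_ineq.

(** The bound contains neither M, psi nor delta; only the smallness of delta depends on M. This is
    what allows the limit in j at fixed M, and then the limit in M. *)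
Lemma test_step (M : R) (Theta eta : R -> R) (psi : Rn -> R) (delta : R) : 0 <= M ->
  (forall s : R, is_derive s 1 Theta (slope al M s)) ->
  (forall s : R, is_derive s 1 eta (slope al M s `^ p)) ->
  Theta 0 = 0 /\ eta 0 = 0 ->
  (forall s, 0 <= eta s <= slope al M s `^ (p - 1) * Theta s) ->
  (forall s, expm1x al (clamp M s) <= Theta s /\ slope al M s <= 2 * al * (1 + Theta s)) ->
  lip0 Omega psi ->
  (rint (fun x => qnorm (Q x) (grad psi x - G x) `^ p)%R <= delta%:E)%E ->
  (2 `^ (p + 1) + 1) * 3 `^ p * (al * (expR (al * M) - 1)) `^ p * delta <= 1 ->
  (rint (fun x => Theta (psi x) `^ (p * sigma) * v x)%R <= ((S * 3) `^ sigma)%:E)%E.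
Proof.
move=> M0 dTh de [Th0 e0] eTh ThE psiL dI Hdelta.
have p0 : 0 < p by rewrite (lt_trans _ p1).
have mO : measurable Omega by exact: open_measurable_rV.
set L := al * (expR (al * M) - 1) in Hdelta.
have L0 : 0 <= L by rewrite mulr_ge0 ?(ltW al0)// subr_ge0 -expR0 ler_expR mulr_ge0// ltW.
have m0 : 0 <= m by rewrite -lee_fin (le_trans _ vm)// rint_ge0//; exact: vw.2.
have slL s : `|slope al M s| <= L by rewrite ger0_norm ?slope_ge0// slope_le.
have ThL := derive_lipschitz dTh slL.
have slpL s : `|slope al M s `^ p| <= L `^ p.
  rewrite (ger0_norm (powR_ge0 _ _)).
  exact: (le_powR2 (ltW p0) (slope_ge0 al0 M0 s) (slope_le M al0 s)).
have eL := derive_lipschitz de slpL.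
have mpsi : measurable_fun Omega psi.
  exact: (continuous_measurable_rV mO (lip0_continuous psiL)).
have mcomp (k : R -> R) : continuous k -> measurable_fun Omega (fun x => k (psi x)).
  by move=> ck; exact: (measurableT_comp (continuous_measurable_fun ck) mpsi).
have mgrad : measurable_vfun Omega (grad psi) := measurable_grad mO psiL.
have mnorm (h : Rn -> R) : measurable_fun Omega h -> measurable_fun Omega (fun x => `|h x|).
  by move=> mh; exact: (measurableT_comp (@normr_measurable R setT) mh).
have ePhi x : Omega x -> grad (eta \o psi) x = slope al M (psi x) `^ p *: grad psi x.
  by move=> Ox; exact: (grad_comp psiL Ox de).
have eTheta x : Omega x -> grad (Theta \o psi) x = slope al M (psi x) *: grad psi x.
  by move=> Ox; exact: (grad_comp psiL Ox dTh).
have etaLip : lip0 Omega (eta \o psi) := lip0_comp psiL e0 eL.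
have ThetaLip : lip0 Omega (Theta \o psi) := lip0_comp psiL Th0 ThL.
have Th_ge0 s : 0 <= Theta s by rewrite (le_trans _ (ThE s).1)// expm1x_ge0.
pose a x := qnorm (Q x) (G x).
pose b x := qnorm (Q x) (grad psi x).
pose dd x := qnorm (Q x) (grad psi x - G x).
pose ip x := dotp (grad psi x) (appmx (Q x) (G x)).
pose th x := slope al M (psi x).
have ma : measurable_fun Omega a := measurable_qnorm mQ mG Q0.
have mb : measurable_fun Omega b := measurable_qnorm mQ mgrad Q0.
have md : measurable_fun Omega dd := measurable_qnorm mQ (measurable_vfunB mgrad mG) Q0.
have mip : measurable_fun Omega ip.
  exact: (measurable_dotp mgrad (measurable_appmx mQ mG)).
have mth : measurable_fun Omega th := mcomp _ (@slope_continuous _ al M).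
have th0 x : 0 <= th x by exact: slope_ge0.
have thE x : Omega x -> qnorm (Q x) (grad (Theta \o psi) x) `^ p = (th x * b x) `^ p.
  by move=> Ox; rewrite (eTheta _ Ox) qnormZ (ger0_norm (slope_ge0 al0 M0 _)).
have thpL x : th x `^ p <= L `^ p := le_powR2 (ltW p0) (th0 x) (slope_le M al0 _).
(* [weak_ineq] asks for test functions of finite energy; this holds because grad psi is the sum of G
   and a small error. *)
have etaI : (rint (fun x => qnorm (Q x) (grad (eta \o psi) x) `^ p)%R < +oo)%E.
  have C0 : 0 <= (L `^ p) `^ p * 2 `^ p by rewrite mulr_ge0 ?powR_ge0.
  have mgeta : measurable_vfun Omega (grad (eta \o psi)) := measurable_grad mO etaLip.
  have m1 : measurable_fun Omega (fun x => qnorm (Q x) (grad (eta \o psi) x) `^ p).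
    exact: (measurable_powR_comp p (measurable_qnorm mQ mgeta Q0)).
  have dfin : (rint (fun x => dd x `^ p)%R < +oo)%E by rewrite (le_lt_trans dI)// ltry.
  have pos (h : Rn -> R) : forall x, Omega x -> 0 <= h x `^ p by move=> x _; exact: powR_ge0.
  apply: le_lt_trans (le_rint_comb leb mO m1 (measurable_powR_comp p ma)
    (measurable_powR_comp p md) C0 C0 (pos _) (pos _) (pos _) _) _.
    move=> x Ox; rewrite (ePhi x Ox) qnormZ (ger0_norm (powR_ge0 _ _)).
    rewrite (powRM _ (powR_ge0 _ _) (qnorm_ge0 _ _)) -mulrDr -mulrA.
    apply: (ler_pM (powR_ge0 _ _) (powR_ge0 _ _)).
      exact: (le_powR2 (ltW p0) (powR_ge0 _ _) (thpL x)).
    apply: le_trans (powRD_le (ltW p0) (qnorm_ge0 _ _) (qnorm_ge0 _ _)).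
    exact: (le_powR2 (ltW p0) (qnorm_ge0 _ _) (qnorm_triangle _ _ (Q0 Ox))).
  apply: lte_add_pinfty.
    exact: (EFin_mul_lty C0 (rint_ge0 leb (pos a)) GI).
  exact: (EFin_mul_lty C0 (rint_ge0 leb (pos dd)) dfin).
have weakI : (rint (fun x => a x `^ (p - 2) * (th x `^ p * ip x))%R <=
   rint (fun x => (`|f x| `^ (p - 1) * eta (psi x) +
      `|g x| `^ (p - 1) * (th x `^ p * `|dotp (t x) (grad psi x)|)) * v x)%R)%E.
  have etaP x : Omega x -> 0 <= (eta \o psi) x by move=> _; have /andP[] := eTh (psi x).
  have := weak etaLip etaP etaI.
  have E1 : rint (fun x => qnorm (Q x) (G x) `^ (p - 2) *
      dotp (grad (eta \o psi) x) (appmx (Q x) (G x))) =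
      rint (fun x => a x `^ (p - 2) * (th x `^ p * ip x)).
    by apply: eq_rint => x Ox; rewrite (ePhi x Ox) dotpZl.
  have E2 : rint (fun x => (`|f x| `^ (p - 1) * (eta \o psi) x +
      `|g x| `^ (p - 1) * `|dotp (t x) (grad (eta \o psi) x)|) * v x) =
      rint (fun x => (`|f x| `^ (p - 1) * eta (psi x) +
      `|g x| `^ (p - 1) * (th x `^ p * `|dotp (t x) (grad psi x)|)) * v x).
    apply: eq_rint => x Ox.
    by rewrite (ePhi x Ox) dotpZr normrM (ger0_norm (powR_ge0 _ _)).
  by rewrite E1 E2.
have subI : (rint (fun x => (th x * `|dotp (t x) (grad psi x)|) `^ p * v x)%R <=
   (Ct `^ p)%:E * rint (fun x => (th x * b x) `^ p)%R)%E.
  have := subunit_rint p1 vw Ct0 Qt ThetaLip.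
  have E1 := eq_rint leb thE.
  have E2 : rint (fun x => `|dotp (t x) (grad (Theta \o psi) x)| `^ p * v x) =
      rint (fun x => (th x * `|dotp (t x) (grad psi x)|) `^ p * v x).
    by apply: eq_rint => x Ox; rewrite (eTheta x Ox) dotpZr normrM (ger0_norm (th0 x)).
  by rewrite E1 E2.
have sobI (J : R) : (rint (fun x => (th x * b x) `^ p)%R <= J%:E ->
   rint (fun x => Theta (psi x) `^ (p * sigma) * v x)%R <= ((S * J) `^ sigma)%:E)%E.
  move=> HJ; have s0 : 0 < sigma by rewrite (lt_trans _ s1).
  have := sobolev_rint oO p1 vw s0 QS ThetaLip.
  have E1 := eq_rint leb thE.
  have E2 : rint (fun x => `|(Theta \o psi) x| `^ (p * sigma) * v x) =
      rint (fun x => Theta (psi x) `^ (p * sigma) * v x).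
    by apply: eq_rint => x Ox; rewrite /= (ger0_norm (Th_ge0 _)).
  by rewrite E1 E2 => /(_ J HJ).
have mTh := mcomp _ (is_derive_continuous dTh).
have meta := mcomp _ (is_derive_continuous de).
have mF := measurable_powR_comp (p - 1) (mnorm _ mf).
have mtau := mnorm _ (measurable_dotp mt mgrad).
have pab x : Omega x -> [/\ 0 <= a x, 0 <= b x & 0 <= dd x].
  by move=> _; split; exact: qnorm_ge0.
have pip x : Omega x -> [/\ `|ip x| <= a x * b x, b x <= a x + dd x &
    a x ^+ 2 - a x * dd x <= ip x].
  move=> Ox; split.
  - by rewrite mulrC; exact: (qnorm_cauchy_schwarz _ _ (Q0 Ox)).
  - exact: (qnorm_triangle _ _ (Q0 Ox)).
  - exact: (dotp_qnorm_lower _ _ (Q0 Ox)).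
have pth x : Omega x -> [/\ 0 <= th x, th x <= L, 0 <= Theta (psi x), 0 <= eta (psi x) &
    eta (psi x) <= th x `^ (p - 1) * Theta (psi x) /\
    th x <= 2 * al * (1 + Theta (psi x))].
  move=> _; have /andP[e1 e2] := eTh (psi x); have [_ t2] := ThE (psi x).
  split; [exact: th0|exact: slope_le|exact: Th_ge0|exact: e1|exact: conj e2 t2].
have pF x : Omega x -> [/\ 0 <= `|f x| `^ (p - 1), 0 <= `|g x|,
    0 <= `|dotp (t x) (grad psi x)| & 0 <= v x].
  by move=> Ox; split; [exact: powR_ge0|exact: normr_ge0|exact: normr_ge0|exact: vw.2].
exact: (@energy_bound _ _ _ leb Omega mO p sigma al K L (Ct `^ p) S m delta a b dd ip th
  (fun x => Theta (psi x)) (fun x => eta (psi x)) (fun x => `|f x| `^ (p - 1))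
  (fun x => `|g x|) (fun x => `|dotp (t x) (grad psi x)|) v
  p1 s1 al0 al1 K0 L0 (powR_ge0 _ _) (powR_ge0 _ _) m0 HK Hal Hdelta
  (And4 ma mb md mip) (And3 mth mTh meta) (And4 mF (mnorm _ mg) mtau vw.1)
  pab pip pth pF weakI subI sobI fI gI GI dI vm).
Qed.

(** At fixed M a single psi_j, close enough to u, suffices: the estimate for Theta(psi_j) is carried
    over to u by the Lipschitz bound on Theta, and the cost of the transfer is the + 1 on the
    right. *)
Lemma exp_bound (M : R) (u : Rn -> R) (psi : nat -> Rn -> R) : 0 <= M ->
  measurable_fun Omega u -> (forall j, lip0 Omega (psi j)) ->
  (forall e : R, 0 < e -> exists j,
    (rint (fun x => `|psi j x - u x| `^ p * v x)%R <= e%:E)%E /\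
    (rint (fun x => qnorm (Q x) (grad (psi j) x - G x) `^ p)%R <= e%:E)%E) ->
  (rint (fun x => expm1x al (clamp M (u x)) `^ (p * sigma) * v x)%R <=
   (2 `^ (p * sigma) * ((S * 3) `^ sigma + 1))%:E)%E.
Proof.
move=> M0 mu psiL cvg_psi.
have p0 : 0 < p by rewrite (lt_trans _ p1).
have mO : measurable Omega by exact: open_measurable_rV.
have [Th [et [dTh de Th0 eTh ThE]]] := test_functions al0 M0 p1.
set L := al * (expR (al * M) - 1).
have L0 : 0 <= L by rewrite mulr_ge0 ?(ltW al0)// subr_ge0 -expR0 ler_expR mulr_ge0// ltW.
pose q := p * sigma.
have pq : p <= q by rewrite /q ler_peMr ?(ltW p0)// ltW.
pose Rm := expR (al * M).
(* [c1] multiplies the error in the energy estimate and [c2] the error of the passage from psi_j to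
   u; the accuracy 1/(1 + c1 + c2) makes both at most 1. *)
pose c1 := (2 `^ (p + 1) + 1) * 3 `^ p * L `^ p.
pose c2 := Rm `^ (q - p) * L `^ p.
have c10 : 0 <= c1 by rewrite /c1 !mulr_ge0 ?powR_ge0// addr_ge0 ?powR_ge0.
have c20 : 0 <= c2 by rewrite mulr_ge0 ?powR_ge0.
have c0 : 0 < 1 + c1 + c2 by rewrite -addrA ltr_wpDr// addr_ge0.
have cV0 : 0 < (1 + c1 + c2)^-1 by rewrite invr_gt0.
have [j [uj Gj]] := cvg_psi _ cV0.
have smallE (c : R) : c <= 1 + c1 + c2 -> c * (1 + c1 + c2)^-1 <= 1.
  by move=> cc; rewrite ler_pdivrMr// mul1r.
have H0 := test_step M0 dTh de Th0 eTh ThE (psiL j) Gj (smallE c1 _).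
have H1 : (rint (fun x => Th (psi j x) `^ q * v x)%R <= ((S * 3) `^ sigma)%:E)%E.
  by apply: H0; lra.
have slL s : `|slope al M s| <= L by rewrite ger0_norm ?slope_ge0// slope_le.
have ThL := derive_lipschitz dTh slL.
have Th_ge0 s : 0 <= Th s by rewrite (le_trans _ (ThE s).1)// expm1x_ge0.
have mpsi : measurable_fun Omega (psi j).
  exact: (continuous_measurable_rV mO (lip0_continuous (psiL j))).
have mTh : measurable_fun Omega (fun x => Th (psi j x) `^ q * v x).
  apply: (measurable_funM _ vw.1); apply: measurable_powR_comp.
  exact: (measurableT_comp (continuous_measurable_fun (is_derive_continuous dTh)) mpsi).
have mdiff : measurable_fun Omega (fun x => `|psi j x - u x| `^ p * v x).
  apply: (measurable_funM _ vw.1); apply: measurable_powR_comp.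
  apply: (measurableT_comp (@normr_measurable R setT)).
  exact: (measurable_funB mpsi mu).
have cB : continuous (fun s => expm1x al (clamp M s)).
  move=> s; apply: (@continuous_comp _ _ _ (clamp M) (expm1x al)).
    exact: continuous_clamp.
  exact: (is_derive_continuous (@is_derive_expm1x _ al)).
have mB : measurable_fun Omega (fun x => expm1x al (clamp M (u x)) `^ q * v x).
  apply: (measurable_funM _ vw.1); apply: measurable_powR_comp.
  exact: (measurableT_comp (continuous_measurable_fun cB) mu).
have v0 x : Omega x -> 0 <= v x by exact: vw.2.
have pos (h : Rn -> R) (s : R) : forall x, Omega x -> 0 <= h x `^ s * v x.
  by move=> x Ox; rewrite mulr_ge0 ?powR_ge0 ?v0.
have C0 : 0 <= 2 `^ q * c2 by rewrite mulr_ge0 ?powR_ge0.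
have ptw x : Omega x -> expm1x al (clamp M (u x)) `^ q * v x <=
    2 `^ q * (Th (psi j x) `^ q * v x) + 2 `^ q * c2 * (`|psi j x - u x| `^ p * v x).
  move=> Ox; set B := expm1x al (clamp M (u x)).
  have B0 : 0 <= B <= Rm.
    rewrite expm1x_ge0 /=; apply: (@le_trans _ _ (expR (al * clamp M (u x)))).
      have := mulr_ge0 (ltW al0) (clamp_ge0 M0 (u x)); rewrite /B /expm1x; lra.
    by rewrite /Rm ler_expR ler_pM2l// clamp_le.
  have BT : B <= Th (psi j x) + L * `|psi j x - u x|.
    apply: (le_trans (ThE (u x)).1); have := ThL (u x) (psi j x).
    rewrite (distrC (u x)); have := ler_norm (Th (u x) - Th (psi j x)); lra.
  have z0 : 0 <= L * `|psi j x - u x| by rewrite mulr_ge0.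
  have := ler_wpM2r (v0 x Ox) (truncated_power p0 pq (Th_ge0 _) z0 B0 BT).
  rewrite (powRM _ L0 (normr_ge0 _)) => H; apply: (le_trans H).
  by rewrite le_eqVlt; apply/orP; left; apply/eqP; rewrite /c2; ring.
apply: (le_trans (le_rint_comb leb mO mB mTh mdiff (powR_ge0 _ _) C0
  (pos _ _) (pos _ _) (pos _ _) ptw)).
rewrite mulrDr mulr1 EFinD [X in (_ <= X + _)%E]EFinM; apply: leeD.
  by apply: lee_wpmul2l => //; rewrite lee_fin powR_ge0.
apply: (@le_trans _ _ ((2 `^ q * c2)%:E * ((1 + c1 + c2)^-1)%:E)%E).
  by apply: lee_wpmul2l.
rewrite -EFinM lee_fin -mulrA ler_piMr ?powR_ge0// smallE//.
by rewrite lerDr addr_ge0.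
Qed.

End test_step.

(** * Exponential integrability *)

(** Half of the exponent al s absorbs the power s^r, the other half dominates s / La. The prefactor
    La^(-r) is kept, since it makes the integral small for large La. *)
Lemma young_H_le {R : realType} (al r La s : R) : 0 < al -> 0 < r -> 2 / al <= La -> 0 <= s ->
  young_H r (s / La) <= La `^ (- r) * (2 * r / al) `^ r * expR (al * s).
Proof.
move=> al0 r0 alLa s0.
have La0 : 0 < La by rewrite (lt_le_trans _ alLa)// divr_gt0.
rewrite /young_H (powRM _ s0) ?invr_ge0 ?(ltW La0)//.
have -> : La^-1 `^ r = La `^ (- r).
  by rewrite -powR_inv1 ?(ltW La0)// -powRrM mulN1r.
rewrite (mulrC (s `^ r)) -2!(mulrA (La `^ (- r))) ler_wpM2l ?powR_ge0//.
have h1 : s `^ r <= (2 * r / al) `^ r * expR (al * s / 2).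
  have c0 : 0 <= 2 * r / al by rewrite divr_ge0 ?mulr_ge0 ?ltW.
  have -> : expR (al * s / 2) = expR (al * s / (2 * r)) `^ r.
    by rewrite /powR gt_eqF ?expR_gt0// expRK; congr expR; field; rewrite gt_eqF.
  rewrite -powRM ?expR_ge0//; apply: le_powR2 => //; first exact: ltW.
  have := expR_ge1Dx (al * s / (2 * r)).
  have sE : s = 2 * r / al * (al * s / (2 * r)).
    by field; rewrite !gt_eqF.
  by move=> H; rewrite {1}sE ler_wpM2l//; lra.
have h2 : expR (s / La) <= expR (al * s / 2).
  rewrite ler_expR mulrAC (mulrC s) ler_wpM2r//.
  by rewrite -[leRHS]invrK invf_div lef_pV2// posrE divr_gt0.
have -> : expR (al * s) = expR (al * s / 2) * expR (al * s / 2).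
  by rewrite -expRD; congr expR; field.
by rewrite (mulrA ((2 * r / al) `^ r)); exact: (ler_pM (powR_ge0 _ _) (expR_ge0 _) h1 h2).
Qed.

Lemma exponential_to_young_H d (T : measurableType d) (R : realType)
    (mu : {measure set T -> \bar R}) (D : set T) (v : T -> R) (al q r m K : R) :
  measurable D -> measurable_fun D v -> (forall x, D x -> 0 <= v x) ->
  0 < al -> 1 <= q -> 0 < r -> 0 <= m -> 0 <= K -> (rint mu D v <= m%:E)%E ->
  exists2 La : R, 0 < La & forall u : T -> R, measurable_fun D u ->
    (forall M : R, 0 <= M ->
      (rint mu D (fun x => expm1x al (clamp M (u x)) `^ q * v x)%R <= K%:E)%E) ->
    (rint mu D (fun x => young_H r (Num.max (u x) 0 / La) * v x)%R <= (1 / 2)%:E)%E.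
Proof.
move=> mD mv v0 al0 q1 r0 m0 K0 vm.
pose c0 := (2 * r / al) `^ r.
have c00 : 0 <= c0 by exact: powR_ge0.
(* The first entry is required by [young_H_le]; the second makes La^(-r) small enough to bring the
   final integral below 1/2. *)
pose La := Num.max (2 / al) ((4 * c0 * (2 * m + K) + 1) `^ r^-1).
have La_al : 2 / al <= La by rewrite /La le_max lexx.
have La0 : 0 < La by rewrite (lt_le_trans _ La_al)// divr_gt0.
have mK : 0 <= 2 * m + K by rewrite addr_ge0// mulr_ge0.
have Z0 : 0 <= 4 * c0 * (2 * m + K) + 1 by rewrite addr_ge0// !mulr_ge0.
have LaZ : 4 * c0 * (2 * m + K) + 1 <= La `^ r.
  have h : (4 * c0 * (2 * m + K) + 1) `^ r^-1 <= La by rewrite /La le_max lexx orbT.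
  have := le_powR2 (ltW r0) (powR_ge0 _ _) h.
  by rewrite -powRrM mulVf ?gt_eqF// powRr1.
have Lar0 : 0 < La `^ r by rewrite powR_gt0.
pose a := La `^ (- r) * c0 * 2.
have a0 : 0 <= a by rewrite !mulr_ge0 ?powR_ge0.
have aK : a * (2 * m + K) <= 1 / 2.
  rewrite /a powRN (_ : _ * _ = 2 * c0 * (2 * m + K) / La `^ r); last by field; rewrite gt_eqF.
  by rewrite ler_pdivrMr//; lra.
exists La => // u mu_ H.
have mclamp (M : R) : measurable_fun D (fun x => clamp M (u x)).
  exact: (measurableT_comp (continuous_measurable_fun (@continuous_clamp R M)) mu_).
have mH (M : R) : measurable_fun D (fun x => young_H r (clamp M (u x) / La) * v x).
  have md : measurable_fun D (fun x => clamp M (u x) / La).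
    exact: (measurable_funM (mclamp M) (measurable_cst _)).
  have me : measurable_fun D (fun x => expR (clamp M (u x) / La)).
    exact: (measurableT_comp (@measurable_expR R) md).
  exact: (measurable_funM (measurable_funM (measurable_powR_comp r md) me) mv).
have H0 s : 0 <= young_H r s by rewrite mulr_ge0 ?powR_ge0 ?expR_ge0.
have bound (M : R) : 0 <= M ->
    (rint mu D (fun x => young_H r (clamp M (u x) / La) * v x)%R <= (1 / 2)%:E)%E.
  move=> M0; pose B x := expm1x al (clamp M (u x)).
  have mB : measurable_fun D (fun x => B x `^ q * v x).
    apply: (measurable_funM _ mv); apply: measurable_powR_comp.
    exact: (measurableT_comp (continuous_measurable_fun
      (is_derive_continuous (@is_derive_expm1x _ al))) (mclamp M)).
  have ptw x : D x -> young_H r (clamp M (u x) / La) * v x <= a * 2 * v x + a * (B x `^ q * v x).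
    move=> Dx; have s0 := clamp_ge0 M0 (u x).
    rewrite mulrA -mulrDl ler_wpM2r ?v0//.
    apply: (le_trans (young_H_le al0 r0 La_al s0)).
    rewrite -/c0 /a -mulrA -(mulrA _ 2 2) -!mulrA -!mulrDr.
    rewrite ler_wpM2l ?powR_ge0// ler_wpM2l//.
    apply: (le_trans (expR_le_expm1x al0 s0)); rewrite ler_wpM2l//.
    have B0 : 0 <= B x by exact: expm1x_ge0.
    (* As q >= 1, B <= 1 + B^q in both cases. *)
    have [B1|B1] := leP 1 (B x); last by have := powR_ge0 (B x) q; rewrite /B in B1 *; lra.
    by have := le1r_powR B1 q1; rewrite -/(B x); lra.
  have pH x : D x -> 0 <= young_H r (clamp M (u x) / La) * v x.
    by move=> Dx; rewrite mulr_ge0 ?v0.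
  have pB x : D x -> 0 <= B x `^ q * v x by move=> Dx; rewrite mulr_ge0 ?powR_ge0 ?v0.
  have a2 : 0 <= a * 2 by rewrite mulr_ge0.
  apply: (le_trans (le_rint_comb mu mD (mH M) mv mB a2 a0 pH v0 pB ptw)).
  apply: (@le_trans _ _ ((a * 2)%:E * m%:E + a%:E * K%:E)%E).
    by apply: leeD; apply: lee_wpmul2l => //; exact: H.
  by rewrite -!EFinM -EFinD lee_fin -mulrA -mulrDr.
(* Monotone convergence as the truncation height k increases; at each point the sequence is
   eventually constant. *)
pose gn (k : nat) x := (young_H r (clamp k%:R (u x) / La) * v x)%:E.
have gE x : D x -> (gn k x @[k --> \oo] --> (young_H r (Num.max (u x) 0 / La) * v x)%:E)%E.
  move=> Dx; apply: cvg_near_cst.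
  have := nbhs_infty_ger (Num.max (u x) 0); apply: filterS => k uk.
  by rewrite /gn /clamp min_l.
have mono x : D x -> {homo gn^~ x : k l / (k <= l)%N >-> (k <= l)%E}.
  move=> Dx k l kl; rewrite /gn lee_fin ler_wpM2r ?v0//.
  have ck : 0 <= clamp k%:R (u x) by exact: clamp_ge0.
  have cl : clamp k%:R (u x) <= clamp l%:R (u x) by rewrite le_min2// ler_nat.
  have cl' : clamp k%:R (u x) / La <= clamp l%:R (u x) / La.
    by rewrite ler_wpM2r// invr_ge0 ltW.
  apply: ler_pM; rewrite ?powR_ge0 ?expR_ge0 ?ler_expR//.
  by apply: le_powR2; rewrite ?(ltW r0)// divr_ge0 ?(ltW La0).
have mg k : measurable_fun D (gn k) by exact/measurable_EFinP.
have g0 k x : D x -> (0 <= gn k x)%E by move=> Dx; rewrite lee_fin mulr_ge0 ?v0.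
have cv := @cvg_monotone_convergence _ _ _ mu D mD gn mg g0 mono.
have -> : rint mu D (fun x => young_H r (Num.max (u x) 0 / La) * v x) =
    (\int[mu]_(x in D) lim (gn^~ x @ \oo))%E.
  by apply: eq_integral => x; rewrite inE => Dx; apply/esym/cvg_lim => //; exact: gE.
rewrite -(cvg_lim _ cv)//; apply: lime_le; first by apply/cvg_ex; eexists; exact: cv.
by apply: nearW => k; exact: bound.
Qed.

(** * Weak inequalities *)

Section weak_inequalities.
Context {R : realType} {n : nat}.
Local Notation Rn := ('rV[R]_n.+1).
Variables (Omega : set Rn) (p : R) (v : Rn -> R) (t : Rn -> Rn).
Hypotheses (oO : open Omega) (p1 : 1 < p) (vw : weight Omega v).
Hypothesis mt : measurable_vfun Omega t.
Variable Q : Rn -> 'M[R]_n.+1.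
Hypotheses (mQ : measurable_mxfun Omega Q) (Q0 : forall x, Omega x -> nonneg_sym (Q x)).
Implicit Types (f g u phi : Rn -> R) (G : Rn -> Rn).
Local Notation rint := (rint leb Omega).

Let p0 : 0 < p. Proof. exact: lt_trans p1. Qed.
Let mO : measurable Omega. Proof. exact: open_measurable_rV. Qed.
Let p2E : p - 2 + 1 = p - 1. Proof. lra. Qed.
Let p2n0 : p - 2 + 1 != 0. Proof. by rewrite p2E subr_eq0 gt_eqF. Qed.

Let powRB2 (x : R) : 0 <= x -> x `^ (p - 2) * x = x `^ (p - 1).
Proof. by move=> x0; rewrite powRD1// p2E. Qed.

Lemma abse_weak_rhs f g phi : measurable_fun Omega f -> measurable_fun Omega g ->
  lip0 Omega phi -> (forall x, Omega x -> 0 <= phi x) ->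
  (`|weak_rhs v Omega p t f g phi| <=
   rint (fun x => (`|f x| `^ (p - 1) * phi x +
                   `|g x| `^ (p - 1) * `|dotp (t x) (grad phi x)|) * v x)%R)%E.
Proof.
move=> mf mg phiL phi0.
have mphi : measurable_fun Omega phi.
  exact: (continuous_measurable_rV mO (lip0_continuous phiL)).
have mnorm (h : Rn -> R) : measurable_fun Omega h -> measurable_fun Omega (fun x => `|h x|).
  by move=> mh; exact: (measurableT_comp (@normr_measurable R setT) mh).
have mgrad := measurable_grad mO phiL.
have mtau := measurable_dotp mt mgrad.
have mf2 := measurable_powR_comp (p - 2) (mnorm _ mf).
have mg2 := measurable_powR_comp (p - 2) (mnorm _ mg).
have mf1 := measurable_powR_comp (p - 1) (mnorm _ mf).
have mg1 := measurable_powR_comp (p - 1) (mnorm _ mg).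
pose k x := (f x * `|f x| `^ (p - 2) * phi x +
      `|g x| `^ (p - 2) * g x * dotp (t x) (grad phi x)) * v x.
have mk : measurable_fun Omega k.
  have m1 := measurable_funM (measurable_funM mf mf2) mphi.
  have m2 := measurable_funM (measurable_funM mg2 mg) mtau.
  exact: (measurable_funM (measurable_funD m1 m2) vw.1).
have mk' : measurable_fun Omega (fun x => (`|f x| `^ (p - 1) * phi x +
    `|g x| `^ (p - 1) * `|dotp (t x) (grad phi x)|) * v x).
  have m1 := measurable_funM mf1 mphi.
  have m2 := measurable_funM mg1 (mnorm _ mtau).
  exact: (measurable_funM (measurable_funD m1 m2) vw.1).
have mK : measurable_fun Omega (fun x => (k x)%:E) by exact/measurable_EFinP.
apply: (le_trans (le_abse_integral leb mO mK)).
apply: (le_rint leb mO (mnorm _ mk) mk') => x Ox; first exact: normr_ge0.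
rewrite /k normrM (ger0_norm (vw.2 _ Ox)) ler_wpM2r ?vw.2//.
apply: (le_trans (ler_normD _ _)); apply: lerD.
  rewrite !normrM (ger0_norm (powR_ge0 _ _)) (ger0_norm (phi0 _ Ox)).
  by rewrite (mulrC `|f x|) powRB2.
by rewrite !normrM (ger0_norm (powR_ge0 _ _)) powRB2.
Qed.

Lemma weak_ineq_subsolution f g u G : measurable_fun Omega f -> measurable_fun Omega g ->
  weak_subsolution v Q Omega p t f g u G -> weak_ineq Omega p v t Q f g G.
Proof.
move=> mf mg [_ sub] phi phiL phi0 _.
apply: (le_trans (sub phi phiL phi0)); apply: (le_trans (lee_abs _)).
exact: abse_weak_rhs.
Qed.

(** The integrand changes sign, so constants can be moved out of the integral only once it is
    integrable. The finite energy condition in [weak_ineq] serves this purpose. *)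
Lemma integrable_weak_lhs G phi : measurable_vfun Omega G ->
  (rint (fun x => qnorm (Q x) (G x) `^ p)%R < +oo)%E -> lip0 Omega phi ->
  (rint (fun x => qnorm (Q x) (grad phi x) `^ p)%R < +oo)%E ->
  leb.-integrable Omega (EFin \o (fun x =>
    qnorm (Q x) (G x) `^ (p - 2) * dotp (grad phi x) (appmx (Q x) (G x)))).
Proof.
move=> mG GI phiL phiI.
have mgrad := measurable_grad mO phiL.
have ma := measurable_qnorm mQ mG Q0.
have mb := measurable_qnorm mQ mgrad Q0.
have map := measurable_powR_comp p ma.
have mbp := measurable_powR_comp p mb.
have mip := measurable_dotp mgrad (measurable_appmx mQ mG).
have mw := measurable_funM (measurable_powR_comp (p - 2) ma) mip.
apply: (integrable_le mO mw (measurable_funD map mbp)) => [x Ox|].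
  rewrite normrM (ger0_norm (powR_ge0 _ _)).
  apply: (le_trans _ (young_add p1 (qnorm_ge0 _ _) (qnorm_ge0 _ _))).
  rewrite -powRB2 ?qnorm_ge0// -mulrA ler_wpM2l ?powR_ge0// mulrC.
  exact: (qnorm_cauchy_schwarz _ _ (Q0 Ox)).
have pos (h : Rn -> R) : forall x, Omega x -> 0 <= h x `^ p by move=> x _; exact: powR_ge0.
have -> := rintD leb mO map mbp (pos _) (pos _).
exact: (lte_add_pinfty GI phiI).
Qed.

(** The left-hand side is odd in G, and the bound on the right-hand side ignores signs. *)
Lemma weak_ineq_supersolution f g u G : measurable_fun Omega f -> measurable_fun Omega g ->
  measurable_vfun Omega G -> (rint (fun x => qnorm (Q x) (G x) `^ p)%R < +oo)%E ->
  weak_supersolution v Q Omega p t f g u G ->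
  weak_ineq Omega p v t Q f g (fun x => (-1) *: G x).
Proof.
move=> mf mg mG GI [_ sup] phi phiL phi0 phiI.
have I := integrable_weak_lhs mG GI phiL phiI.
have -> : rint (fun x => qnorm (Q x) ((-1) *: G x) `^ (p - 2) *
    dotp (grad phi x) (appmx (Q x) ((-1) *: G x)))%R = (- weak_lhs Q Omega p G phi)%E.
  rewrite -mulN1e; have <- := integralZl mO I (-1).
  apply: eq_integral => x _ /=; rewrite appmxZ dotpZr qnormZ normrN1 mul1r.
  by rewrite -EFinM; congr (_%:E); ring.
apply: (le_trans (_ : _ <= - weak_rhs v Omega p t f g phi)%E).
  by rewrite leeN2; exact: sup.
apply: (le_trans (lee_abs _)); rewrite abseN; exact: abse_weak_rhs.
Qed.

(** Both sides are homogeneous of degree p - 1 in (G, f, g). *)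
Lemma weak_ineq_scale f g G (l : R) : 0 < l -> measurable_fun Omega f -> measurable_fun Omega g ->
  measurable_vfun Omega G -> (rint (fun x => qnorm (Q x) (G x) `^ p)%R < +oo)%E ->
  weak_ineq Omega p v t Q f g G ->
  weak_ineq Omega p v t Q (fun x => f x / l) (fun x => g x / l) (fun x => l^-1 *: G x).
Proof.
move=> l0 mf mg mG GI weak phi phiL phi0 phiI.
have I := integrable_weak_lhs mG GI phiL phiI.
have lV0 : 0 < l^-1 by rewrite invr_gt0.
have c0 : 0 <= l^-1 `^ (p - 1) by exact: powR_ge0.
have mnorm (h : Rn -> R) : measurable_fun Omega h -> measurable_fun Omega (fun x => `|h x|).
  by move=> mh; exact: (measurableT_comp (@normr_measurable R setT) mh).
have mphi : measurable_fun Omega phi.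
  exact: (continuous_measurable_rV mO (lip0_continuous phiL)).
have mtau := mnorm _ (measurable_dotp mt (measurable_grad mO phiL)).
have mf1 := measurable_powR_comp (p - 1) (mnorm _ mf).
have mg1 := measurable_powR_comp (p - 1) (mnorm _ mg).
have mk : measurable_fun Omega (fun x => (`|f x| `^ (p - 1) * phi x +
    `|g x| `^ (p - 1) * `|dotp (t x) (grad phi x)|) * v x).
  have m1 := measurable_funM mf1 mphi.
  have m2 := measurable_funM mg1 mtau.
  exact: (measurable_funM (measurable_funD m1 m2) vw.1).
have k0 x : Omega x -> 0 <= (`|f x| `^ (p - 1) * phi x +
    `|g x| `^ (p - 1) * `|dotp (t x) (grad phi x)|) * v x.
  by move=> Ox; rewrite mulr_ge0 ?vw.2// addr_ge0// mulr_ge0 ?powR_ge0// phi0.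
have normE h x : `|h x / l| `^ (p - 1) = l^-1 `^ (p - 1) * `|h x| `^ (p - 1) :> R.
  by rewrite normrM (gtr0_norm lV0) powRM ?(ltW lV0)// mulrC.
have -> : rint (fun x => qnorm (Q x) (l^-1 *: G x) `^ (p - 2) *
    dotp (grad phi x) (appmx (Q x) (l^-1 *: G x)))%R =
    ((l^-1 `^ (p - 1))%:E * rint (fun x => qnorm (Q x) (G x) `^ (p - 2) *
    dotp (grad phi x) (appmx (Q x) (G x)))%R)%E.
  have <- := integralZl mO I (l^-1 `^ (p - 1)).
  apply: eq_integral => x _ /=; rewrite appmxZ dotpZr qnormZ (gtr0_norm lV0).
  rewrite (powRM _ (ltW lV0) (qnorm_ge0 _ _)) -EFinM -(powRB2 (ltW lV0)).
  by congr (_%:E); ring.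
have -> : rint (fun x => (`|f x / l| `^ (p - 1) * phi x +
      `|g x / l| `^ (p - 1) * `|dotp (t x) (grad phi x)|) * v x)%R =
    ((l^-1 `^ (p - 1))%:E * rint (fun x => (`|f x| `^ (p - 1) * phi x +
      `|g x| `^ (p - 1) * `|dotp (t x) (grad phi x)|) * v x)%R)%E.
  have <- := rintZ leb mO c0 mk k0.
  by apply: eq_rint => x Ox; rewrite !normE; ring.
by apply: lee_wpmul2l; [rewrite lee_fin|exact: weak].
Qed.

Lemma QH1p0_approx u G (c : R) : QH1p0 v Q Omega p u G -> exists psi : nat -> Rn -> R,
  (forall j, lip0 Omega (psi j)) /\
  (forall e : R, 0 < e -> exists j,
    (rint (fun x => `|psi j x - c * u x| `^ p * v x)%R <= e%:E)%E /\
    (rint (fun x => qnorm (Q x) (grad (psi j) x - c *: G x) `^ p)%R <= e%:E)%E).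
Proof.
move=> [[mu _] [mG _] [psi [psiL cvu cvG]]].
have dc (s : R) : is_derive s 1 (fun s => c * s) c.
  have := is_deriveZ c (@is_derive_id _ _ s 1).
  by rewrite /GRing.scale /= mulr1.
have cL (s s' : R) : `|c * s - c * s'| <= `|c| * `|s - s'| by rewrite -mulrBr normrM.
exists (fun j => (fun s => c * s) \o psi j); split=> [j|e e0].
  by apply: lip0_comp (psiL j) _ cL; rewrite mulr0.
(* Multiplication by c costs |c|^p in the integrals; the + 1 covers c = 0. *)
pose e' := (e / (`|c| `^ p + 1)) `^ p^-1.
have c1 : 0 < `|c| `^ p + 1 by rewrite ltr_wpDl ?powR_ge0.
have e'0 : 0 < e' by rewrite powR_gt0// divr_gt0.
have e'p : e' `^ p = e / (`|c| `^ p + 1).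
  by rewrite -powRrM mulVf ?gt_eqF// powRr1// divr_ge0 ?(ltW e0) ?(ltW c1).
have cle : `|c| `^ p * e' `^ p <= e.
  by rewrite e'p mulrCA ler_piMr ?(ltW e0)// ler_pdivrMr// mul1r lerDl.
have near0 (X : nat -> \bar R) : X @ \oo --> 0%E -> \forall j \near \oo, (X j < e'%:E)%E.
  move=> X0; apply: (X0 [set x | (x < e'%:E)%E]); apply: open_nbhs_nbhs; split.
    exact: open_ereal_lt_ereal.
  by rewrite /= lte_fin.
have [j [ju jG]] : exists j, (Lp_norm v Omega p (fun x => psi j x - u x)%R < e'%:E)%E /\
    (QLp_norm Q Omega p (fun x => grad (psi j) x - G x)%R < e'%:E)%E.
  have [j _ Hj] := filterI (near0 _ cvu) (near0 _ cvG).
  by exists j; exact: (Hj j (leqnn j)).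
exists j.
have mpsi : measurable_fun Omega (psi j).
  exact: (continuous_measurable_rV mO (lip0_continuous (psiL j))).
have mgrad := measurable_grad mO (psiL j).
have c0 : 0 <= `|c| `^ p by exact: powR_ge0.
have m1 : measurable_fun Omega (fun x => `|psi j x - u x| `^ p * v x).
  apply: (measurable_funM _ vw.1); apply: measurable_powR_comp.
  apply: (measurableT_comp (@normr_measurable R setT)).
  exact: (measurable_funB mpsi mu).
have m2 : measurable_fun Omega (fun x => qnorm (Q x) (grad (psi j) x - G x) `^ p).
  apply: measurable_powR_comp.
  exact: (measurable_qnorm mQ (measurable_vfunB mgrad mG) Q0).
have pos1 x : Omega x -> 0 <= `|psi j x - u x| `^ p * v x.
  by move=> Ox; rewrite mulr_ge0 ?powR_ge0 ?vw.2.
have pos2 x : Omega x -> 0 <= qnorm (Q x) (grad (psi j) x - G x) `^ p.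
  by move=> _; exact: powR_ge0.
have final (X : \bar R) : (0 <= X)%E -> (poweR X p^-1 < e'%:E)%E ->
    ((`|c| `^ p)%:E * X <= e%:E)%E.
  move=> X0 /ltW; rewrite (le_poweR_inv p0 X0 (ltW e'0)) => H.
  apply: (@le_trans _ _ ((`|c| `^ p)%:E * (e' `^ p)%:E)%E).
    by apply: lee_wpmul2l.
  by rewrite -EFinM lee_fin.
split.
  have -> : rint (fun x => `|((fun s => c * s) \o psi j) x - c * u x| `^ p * v x)%R =
      ((`|c| `^ p)%:E * rint (fun x => `|psi j x - u x| `^ p * v x)%R)%E.
    have <- := rintZ leb mO c0 m1 pos1.
    apply: eq_rint => x Ox; rewrite /= -mulrBr normrM powRM//; ring.
  exact: (final _ (rint_ge0 leb pos1) ju).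
have -> : rint (fun x => qnorm (Q x) (grad ((fun s => c * s) \o psi j) x - c *: G x) `^ p)%R =
    ((`|c| `^ p)%:E * rint (fun x => qnorm (Q x) (grad (psi j) x - G x) `^ p)%R)%E.
  have <- := rintZ leb mO c0 m2 pos2.
  apply: eq_rint => x Ox; rewrite (grad_comp (psiL j) Ox dc) -scalerBr qnormZ.
  by rewrite powRM ?qnorm_ge0.
exact: (final _ (rint_ge0 leb pos2) jG).
Qed.

End weak_inequalities.

(** * Conclusion *)

Section main.
Context {R : realType} {n : nat}.
Local Notation Rn := ('rV[R]_n.+1).
Variables (Omega : set Rn) (p sigma r : R) (v : Rn -> R) (t : Rn -> Rn) (Ct SN : R).
Hypotheses (oO : open Omega) (p1 : 1 < p) (s1 : 1 < sigma) (r0 : 0 < r).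
Hypotheses (vw : weight Omega v) (vI : leb.-integrable Omega (EFin \o v)).
Hypotheses (mt : measurable_vfun Omega t) (Ct0 : 0 < Ct).
Local Notation rint := (rint leb Omega).

Let p0 : 0 < p. Proof. exact: lt_trans p1. Qed.
Let mO : measurable Omega. Proof. exact: open_measurable_rV. Qed.

(** [La] is quantified before Q, the data and the solution, which records what the constant depends
    on. *)
Lemma normalized_bound : exists2 La : R, 0 < La &
  forall (Q : Rn -> 'M[R]_n.+1) (f g u : Rn -> R) (G : Rn -> Rn),
    measurable_mxfun Omega Q -> (forall x, Omega x -> nonneg_sym (Q x)) ->
    subunit v Q Omega p t Ct -> Sobolev v Q Omega p (young_N sigma p) SN ->
    measurable_fun Omega f -> measurable_fun Omega g ->
    (rint (fun x => (`|f x| `^ (p - 1)) `^ conj_exp sigma * v x)%R <= 1)%E ->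
    (rint (fun x => (`|g x| `^ p) `^ conj_exp sigma * v x)%R <= 1)%E ->
    measurable_fun Omega u -> measurable_vfun Omega G ->
    (rint (fun x => qnorm (Q x) (G x) `^ p)%R < +oo)%E ->
    weak_ineq Omega p v t Q f g G ->
    (exists psi : nat -> Rn -> R, (forall j, lip0 Omega (psi j)) /\
      (forall e : R, 0 < e -> exists j,
        (rint (fun x => `|psi j x - u x| `^ p * v x)%R <= e%:E)%E /\
        (rint (fun x => qnorm (Q x) (grad (psi j) x - G x) `^ p)%R <= e%:E)%E)) ->
    (rint (fun x => young_H r (Num.max (u x) 0 / La) * v x)%R <= (1 / 2)%:E)%E.
Proof.
have v0 : (0 <= rint v)%E by apply: rint_ge0; exact: vw.2.
pose m := fine (rint v).
have mE : rint v = m%:E by rewrite fineK//; exact: integrable_fin_num.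
have m0 : 0 <= m by rewrite -lee_fin -mE.
have vm : (rint v <= m%:E)%E by rewrite mE.
pose S := (`|SN| + 1) `^ p.
have S0 : 0 <= S by exact: powR_ge0.
have Ctp : 0 < Ct `^ p by exact: powR_gt0.
have [K [al [K0 al0 al1 HK Hal]]] := energy_constants p1 Ctp S0 m0.
have q1 : 1 <= p * sigma by rewrite (le_trans (ltW p1))// ler_peMr ?(ltW p0)// ltW.
have K20 : 0 <= 2 `^ (p * sigma) * ((S * 3) `^ sigma + 1).
  by rewrite mulr_ge0 ?addr_ge0 ?powR_ge0.
have [La La0 HLa] := exponential_to_young_H mO vw.1 vw.2 al0 q1 r0 m0 K20 vm.
exists La => // Q f g u G mQ Q0 Qt QS mf mg fI gI mu mG GI weak [psi [psiL cpsi]].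
apply: HLa => // M M0.
exact: (exp_bound oO p1 s1 vw mt Ct0 vm K0 al0 al1 HK Hal mQ Q0 Qt QS mf mg fI gI
  mG GI weak M0 mu psiL cpsi).
Qed.

(** The factor s will be 1 for subsolutions and -1 for supersolutions; [normalized_bound] is applied
    to (s / l) u. *)
Lemma scaled_bound : exists2 La : R, 0 < La &
  forall (Q : Rn -> 'M[R]_n.+1) (f g u : Rn -> R) (G : Rn -> Rn) (s l : R),
    measurable_mxfun Omega Q -> (forall x, Omega x -> nonneg_sym (Q x)) ->
    subunit v Q Omega p t Ct -> Sobolev v Q Omega p (young_N sigma p) SN ->
    measurable_fun Omega f -> measurable_fun Omega g -> 0 < l ->
    (Orlicz_norm (young_A sigma p) v Omega f < l%:E)%E ->
    (Orlicz_norm (young_B sigma p) v Omega g < l%:E)%E ->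
    QH1p0 v Q Omega p u G ->
    weak_ineq Omega p v t Q f g (fun x => s *: G x) ->
    (rint (fun x => young_H r (Num.max (s * u x) 0 / (La * l)) * v x)%R <= (1 / 2)%:E)%E.
Proof.
have [La La0 H] := normalized_bound; exists La => //.
move=> Q f g u G s l mQ Q0 Qt QS mf mg l0 fl gl QH weak.
have [[mu _] [mG GI] _] := QH.
have sig0 : 0 < sigma - 1 by rewrite subr_gt0.
have conj0 : 0 < conj_exp sigma by rewrite divr_gt0// (lt_trans _ s1).
have pm0 : 0 < p - 1 by rewrite subr_gt0.
have fI : (rint (fun x => (`|f x / l| `^ (p - 1)) `^ conj_exp sigma * v x)%R <= 1)%E.
  have := Orlicz_young_rint oO vw (mulr_gt0 conj0 pm0) mf fl.
  apply: le_trans; rewrite le_eqVlt; apply/orP; left; apply/eqP.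
  by apply: eq_rint => x _; rewrite -powRrM (mulrC (p - 1)).
have gI : (rint (fun x => (`|g x / l| `^ p) `^ conj_exp sigma * v x)%R <= 1)%E.
  have := Orlicz_young_rint oO vw (mulr_gt0 p0 conj0) mg gl.
  apply: le_trans; rewrite le_eqVlt; apply/orP; left; apply/eqP.
  by apply: eq_rint => x _; rewrite -powRrM.
have {}GI : (rint (fun x => qnorm (Q x) (G x) `^ p)%R < +oo)%E.
  apply: (@lty_poweRy _ _ p^-1); first by rewrite invr_eq0 gt_eqF.
  exact: GI.
have mGs (c : R) : measurable_vfun Omega (fun x => c *: G x).
  move=> i; have -> : (fun x => (c *: G x) ord0 i) = (fun x => c * G x ord0 i).
    by apply/funext => x; rewrite mxE.
  exact: (measurable_funM (measurable_cst _) (mG i)).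
have GIs (c : R) : (rint (fun x => qnorm (Q x) (c *: G x) `^ p)%R < +oo)%E.
  have m1 := measurable_powR_comp p (measurable_qnorm mQ mG Q0).
  have pos x : Omega x -> 0 <= qnorm (Q x) (G x) `^ p by move=> _; exact: powR_ge0.
  have E := rintZ leb mO (powR_ge0 `|c| p) m1 pos.
  have -> : rint (fun x => qnorm (Q x) (c *: G x) `^ p)%R =
      rint (fun x => `|c| `^ p * qnorm (Q x) (G x) `^ p)%R.
    by apply: eq_rint => x _; rewrite qnormZ powRM ?qnorm_ge0.
  rewrite E; exact: (EFin_mul_lty (powR_ge0 _ _) (rint_ge0 leb pos) GI).
have mfl : measurable_fun Omega (fun x => f x / l).
  exact: (measurable_funM mf (measurable_cst _)).
have mgl : measurable_fun Omega (fun x => g x / l).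
  exact: (measurable_funM mg (measurable_cst _)).
have weakl := weak_ineq_scale oO p1 vw mt mQ Q0 l0 mf mg (mGs s) (GIs s) weak.
have GE : (fun x => l^-1 *: (s *: G x)) = (fun x => (l^-1 * s) *: G x).
  by apply/funext => x; rewrite scalerA.
rewrite GE in weakl.
have mul : measurable_fun Omega (fun x => (l^-1 * s) * u x).
  exact: (measurable_funM (measurable_cst _) mu).
have := H Q _ _ _ _ mQ Q0 Qt QS mfl mgl fI gI mul (mGs _) (GIs _) weakl
  (QH1p0_approx oO p1 vw mQ Q0 (l^-1 * s) QH).
apply: le_trans; rewrite le_eqVlt; apply/orP; left; apply/eqP.
apply: eq_rint => x _; congr (young_H r _ * _).
have -> : Num.max (l^-1 * s * u x) 0 = l^-1 * Num.max (s * u x) 0.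
  by rewrite maxr_pMr ?invr_ge0 ?(ltW l0)// mulr0 mulrA.
by rewrite invfM; ring.
Qed.

Lemma Orlicz_norm_ge0 (Phi : R -> R) (h : Rn -> R) : (0 <= Orlicz_norm Phi v Omega h)%E.
Proof. by apply: le_ereal_inf_tmp => _ [l [l0 _] <-]; rewrite lee_fin ltW. Qed.

Lemma Orlicz_norm_le_scaled (h : Rn -> R) (La a : R) : 0 < La -> 0 <= a ->
  (forall l, a < l ->
    (rint (fun x => young_H r (`|h x| / (La * l)) * v x)%R <= 1)%E) ->
  (Orlicz_norm (young_H r) v Omega h <= (La * a)%:E)%E.
Proof.
move=> La0 a0 H; apply/lee_addgt0Pr => e e0.
have al : a < a + e / La by rewrite ltrDl divr_gt0.
have l0 : 0 < a + e / La by rewrite (le_lt_trans a0).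
have := Orlicz_norm_le (mulr_gt0 La0 l0) (H _ al).
by rewrite mulrDr (mulrC La (e / La)) divfK ?gt_eqF// EFinD.
Qed.

End main.

Theorem corollary1p11 (R : realType) (n : nat) (Omega : set 'rV[R]_n.+1)
    (p sigma r : R) (v : 'rV[R]_n.+1 -> R) (t : 'rV[R]_n.+1 -> 'rV[R]_n.+1)
    (Ct SN : R)
    (Omega_dom : bounded_domain Omega) (p_gt1 : 1 < p)
    (sigma_gt1 : 1 < sigma) (r_gt0 : 0 < r)
    (v_weight : weight Omega v) (v_L1 : leb.-integrable Omega (EFin \o v))
    (t_meas : measurable_vfun Omega t) (Ct_gt0 : 0 < Ct) :
  exists C C' : R, [/\ 0 < C, 0 < C' &
    forall (k : R) (Q : 'rV[R]_n.+1 -> 'M[R]_n.+1),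
      measurable_mxfun Omega Q ->
      (forall x, Omega x -> nonneg_sym (Q x)) ->
      {ae leb, forall x, Omega x -> opnorm (Q x) `^ (p / 2) <= k * v x} ->
      subunit v Q Omega p t Ct ->
      Sobolev v Q Omega p (young_N sigma p) SN ->
    forall f g : 'rV[R]_n.+1 -> R,
      Orlicz_space (young_A sigma p) v Omega f ->
      Orlicz_space (young_B sigma p) v Omega g ->
    forall (u : 'rV[R]_n.+1 -> R) (G : 'rV[R]_n.+1 -> 'rV[R]_n.+1),
      [/\ weak_subsolution v Q Omega p t f g u G ->
            (Orlicz_norm (young_H r) v Omega (u ^\+)%R
             <= C%:E * (Orlicz_norm (young_A sigma p) v Omega f
                        + Orlicz_norm (young_B sigma p) v Omega g))%E,
          weak_supersolution v Q Omega p t f g u G ->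
            (Orlicz_norm (young_H r) v Omega (u ^\-)%R
             <= C%:E * (Orlicz_norm (young_A sigma p) v Omega f
                        + Orlicz_norm (young_B sigma p) v Omega g))%E &
          weak_solution v Q Omega p t f g u G ->
            Orlicz_space (young_H r) v Omega u /\
            (Orlicz_norm (young_H r) v Omega u
             <= C'%:E * (Orlicz_norm (young_A sigma p) v Omega f
                         + Orlicz_norm (young_B sigma p) v Omega g))%E]].

Proof.
have oO : open Omega by case: Omega_dom.
have mO : measurable Omega by exact: open_measurable_rV.
have [La La0 H] := scaled_bound SN oO p_gt1 sigma_gt1 r_gt0 v_weight v_L1 t_meas Ct_gt0.
(* The same constant serves for u, because the bounds on u^+ and u^- leave 1/2 each. *)
exists La, La; split => // k Q mQ Q0 _ Qt QS f g [mf fA] [mg gB] u G.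
have p0 : 0 < p by rewrite (lt_trans _ p_gt1).
have [a a0 aE] : exists2 a : R, 0 <= a & Orlicz_norm (young_A sigma p) v Omega f = a%:E.
  have := Orlicz_norm_ge0 Omega v (young_A sigma p) f; move: fA.
  by case: Orlicz_norm => [a _ a0| |]//; exists a.
have [b b0 bE] : exists2 b : R, 0 <= b & Orlicz_norm (young_B sigma p) v Omega g = b%:E.
  have := Orlicz_norm_ge0 Omega v (young_B sigma p) g; move: gB.
  by case: Orlicz_norm => [b _ b0| |]//; exists b.
rewrite aE bE -EFinD -EFinM.
have ab0 : 0 <= a + b by rewrite addr_ge0.
have lab l : a + b < l -> [/\ 0 < l, a < l & b < l] by move=> abl; split; lra.
have young0 : young_H r 0 = 0 by rewrite /young_H powR0 ?mul0r// gt_eqF.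
have pos_bound : weak_subsolution v Q Omega p t f g u G -> forall l, a + b < l ->
    (rint leb Omega (fun x => young_H r (u^\+ x / (La * l)) * v x)%R <= (1 / 2)%:E)%E.
  move=> sub l /lab[l0 al bl].
  have fl : (Orlicz_norm (young_A sigma p) v Omega f < l%:E)%E by rewrite aE lte_fin.
  have gl : (Orlicz_norm (young_B sigma p) v Omega g < l%:E)%E by rewrite bE lte_fin.
  have weak := weak_ineq_subsolution oO p_gt1 v_weight t_meas mf mg sub.
  have GE : G = (fun x => 1 *: G x) by apply/funext => x; rewrite scale1r.
  rewrite GE in weak.
  have := H Q f g u G 1 l mQ Q0 Qt QS mf mg l0 fl gl sub.1 weak.
  apply: le_trans; rewrite le_eqVlt; apply/orP; left; apply/eqP.
  by apply: eq_rint => x _; rewrite mul1r.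
have neg_bound : weak_supersolution v Q Omega p t f g u G -> forall l, a + b < l ->
    (rint leb Omega (fun x => young_H r (u^\- x / (La * l)) * v x)%R <= (1 / 2)%:E)%E.
  move=> sup l /lab[l0 al bl].
  have fl : (Orlicz_norm (young_A sigma p) v Omega f < l%:E)%E by rewrite aE lte_fin.
  have gl : (Orlicz_norm (young_B sigma p) v Omega g < l%:E)%E by rewrite bE lte_fin.
  have [_ [mG GI] _] := sup.1.
  have GI' : (rint leb Omega (fun x => qnorm (Q x) (G x) `^ p)%R < +oo)%E.
    apply: (@lty_poweRy _ _ p^-1); first by rewrite invr_eq0 gt_eqF.
    exact: GI.
  have weak := weak_ineq_supersolution oO p_gt1 v_weight t_meas mQ Q0 mf mg mG GI' sup.
  have := H Q f g u G (-1) l mQ Q0 Qt QS mf mg l0 fl gl sup.1 weak.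
  apply: le_trans; rewrite le_eqVlt; apply/orP; left; apply/eqP.
  by apply: eq_rint => x _; rewrite mulN1r.
have half1 : ((1 / 2)%:E <= 1 :> \bar R)%E by rewrite lee_fin; lra.
split=> [sub|sup|sol].
- apply: (Orlicz_norm_le_scaled La0 ab0) => l abl; apply: (le_trans _ half1).
  apply: le_trans (pos_bound sub l abl); rewrite le_eqVlt; apply/orP; left; apply/eqP.
  by apply: eq_rint => x _; rewrite (ger0_norm (funrpos_ge0 u x)).
- apply: (Orlicz_norm_le_scaled La0 ab0) => l abl; apply: (le_trans _ half1).
  apply: le_trans (neg_bound sup l abl); rewrite le_eqVlt; apply/orP; left; apply/eqP.
  by apply: eq_rint => x _; rewrite (ger0_norm (funrneg_ge0 u x)).
have sub : weak_subsolution v Q Omega p t f g u G.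
  by split; [exact: sol.1|move=> phi phiL _; rewrite sol.2].
have sup : weak_supersolution v Q Omega p t f g u G.
  by split; [exact: sol.1|move=> phi phiL _; rewrite sol.2].
have [[mu _] _ _] := sol.1.
suff uH : (Orlicz_norm (young_H r) v Omega u <= (La * (a + b))%:E)%E.
  by split; [split; [exact: mu|exact: (le_lt_trans uH (ltry _))]|exact: uH].
apply: (Orlicz_norm_le_scaled La0 ab0) => l abl.
have [l0 _ _] := lab l abl.
have mH (w : 'rV[R]_n.+1 -> R) : measurable_fun Omega w ->
    measurable_fun Omega (fun x => young_H r (w x / (La * l)) * v x).
  move=> mw; have md : measurable_fun Omega (fun x => w x / (La * l)).
    exact: (measurable_funM mw (measurable_cst _)).
  have me := measurableT_comp (@measurable_expR R) md.
  exact: (measurable_funM (measurable_funM (measurable_powR_comp r md) me) v_weight.1).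
have pH (w : 'rV[R]_n.+1 -> R) : forall x, Omega x -> 0 <= young_H r (w x / (La * l)) * v x.
  by move=> x Ox; rewrite mulr_ge0 ?v_weight.2// mulr_ge0 ?powR_ge0 ?expR_ge0.
have E := rintD leb mO (mH _ (measurable_funrpos mu)) (mH _ (measurable_funrneg mu))
  (pH _) (pH _).
(* At each point u^+ or u^- vanishes, and [young_H r 0] is 0 as r > 0. *)
have -> : rint leb Omega (fun x => young_H r (`|u x| / (La * l)) * v x) =
    rint leb Omega (fun x => young_H r (u^\+ x / (La * l)) * v x +
                             young_H r (u^\- x / (La * l)) * v x).
  apply: eq_rint => x _; have /orP[u0|u0] := le_total 0 (u x).
    have -> : u^\+ x = u x by rewrite /funrpos max_l.
    have -> : u^\- x = 0 by rewrite /funrneg max_r// oppr_le0.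
    by rewrite ger0_norm// !mul0r young0 mul0r addr0.
  have -> : u^\+ x = 0 by rewrite /funrpos max_r.
  have -> : u^\- x = - u x by rewrite /funrneg max_l// oppr_ge0.
  by rewrite ler0_norm// !mul0r young0 mul0r add0r.
rewrite E; apply: (@le_trans _ _ ((1 / 2)%:E + (1 / 2)%:E)%E).
  by apply: leeD; [exact: pos_bound|exact: neg_bound].
by rewrite -EFinD lee_fin; lra.
Qed.
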